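(* Let $E$ be a simple, closed, densely defined, symmetric operator with infinite deficiency indices on a complex separable infinite dimensional Hilbert space $\mathfrak{X}$, let $Y\subseteq\mathfrak{X}$ be a closed infinite dimensional subspace, and let $\Omega\subseteq\mathbb{C}$ be a nonempty open set, symmetric about the real axis, consisting of $Y$-regular points of $E$. Then the reproducing kernel Hilbert space $\mathcal{H}_2$ of $Y\oplus Y$ valued functions on $\Omega$ constructed from $E$ (defined in the context) is an $\mathcal{H}_0(U)$ space, with signature operator $J=J_1=\begin{bmatrix}0&I\\ I&0\end{bmatrix}$ (acting on $Y\oplus Y$).
   Context: $B(\mathfrak{K})$ is the space of bounded linear operators on a Hilbert space $\mathfrak{K}$. A symmetric operator $E$ is simple if it has no nonzero reducing subspace on which it is self-adjoint (equivalently $\bigcap_{\xi\in\mathbb{C}\setminus\mathbb{R}}\mathrm{rng}(E-\xi I)=\{0\}$). Write $\mathfrak{M}_\xi=\mathrm{rng}(E-\xi I)$. For a closed subspace $Y$ of $\mathfrak{X}$, a point $\xi\in\mathbb{C}$ is called $Y$-regular for $E$ if $\mathfrak{M}_\xi$ is closed and $\mathfrak{X}=\mathfrak{M}_\xi\dotplus Y$ (direct sum). Every $Y$-regular point is a point of regular type of $E$, i.e. there is $c_\xi>0$ with $\|(E-\xi I)g\|\ge c_\xi\|g\|$ for all $g\in\mathcal{D}(E)$. For $\xi\in\Omega$, $P_Y(\xi)\in B(\mathfrak{X})$ is the projection onto $Y$ along $\mathfrak{M}_\xi$, and $\tau_Y(\xi)\in B(\mathfrak{X})$ is $\tau_Y(\xi)f=(E-\xi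 I)^{-1}(I-P_Y(\xi))f$; thus $f=(E-\xi I)\tau_Y(\xi)f+P_Y(\xi)f$. $\Pi_Y$ denotes the orthogonal projection of $\mathfrak{X}$ onto $Y$. Construction of $\mathcal{H}_2$: for $f\in\mathfrak{X}$ and $\xi\in\Omega$ put $\begin{bmatrix}f_Y\\ \tilde f_Y\end{bmatrix}(\xi)=\begin{bmatrix}P_Y(\xi)f\\ \frac{1}{\pi i}\Pi_Y\bigl(\tau_Y(\xi)f\bigr)\end{bmatrix}\in Y\oplus Y$. Then $\mathcal{H}_2=\left\{\begin{bmatrix}f_Y\\ \tilde f_Y\end{bmatrix}:f\in\mathfrak{X}\right\}$, with inner product $\left\langle\begin{bmatrix}f_Y\\ \tilde f_Y\end{bmatrix},\begin{bmatrix}g_Y\\ \tilde g_Y\end{bmatrix}\right\rangle_{\mathcal{H}_2}=2\langle f,g\rangle_{\mathfrak{X}}$ (well defined because $f\mapsto\begin{bmatrix}f_Y\\ \tilde f_Y\end{bmatrix}$ is injective). $\mathcal{H}(U)$ spaces: let $J$ be a unitary self-adjoint operator on a Hilbert space $\mathfrak{K}$ and $U:\Omega\to B(\mathfrak{K})$ analytic with $U(\lambda)JU(\bar\lambda)^*=J=U(\bar\lambda)^*JU(\lambda)$ for all $\lambda\in\Omega$. Put $\rho_\xi(\lambda)=-2\pi i(\lambda-\bar\xi)$ and $K^U_\xi(\lambda)=\frac{J-U(\lambda)JU(\xi)^*}{\rho_\xi(\lambda)}$ if $\lambda\ne\bar\xi$, $K^U_\xi(\bar\xi)=\frac{U'(\bar\xi)JU(\xi)^*}{2\pi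 i}$. When this kernel is positive on $\Omega\times\Omega$ (i.e. $\sum_{i,j}\langle K^U_{\omega_j}(\omega_i)u_j,u_i\rangle\ge0$ for all finite choices of $\omega_i\in\Omega$, $u_i\in\mathfrak{K}$), $\mathcal{H}(U)$ denotes the unique reproducing kernel Hilbert space of $\mathfrak{K}$-valued analytic functions on $\Omega$ with reproducing kernel $K^U$ (i.e. $K^U_\omega u\in\mathcal{H}(U)$ and $\langle f,K^U_\omega u\rangle_{\mathcal{H}(U)}=\langle f(\omega),u\rangle$ for all $\omega\in\Omega$, $u\in\mathfrak{K}$, $f\in\mathcal{H}(U)$). Here $\mathfrak{K}=Y\oplus Y$. A space of functions on $\Omega$ is an $\mathcal{H}_0(U)$ space (with signature operator $J$) if it equals $\mathcal{H}(U)$ for some such $U$ for which, for every $\lambda\in\Omega$, the operator $I-U(\lambda)$ is not compact. *)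

(* Defs.v *)
From HB Require Import structures.
From mathcomp Require Import all_boot all_order all_algebra.
From mathcomp Require Import all_classical all_reals all_analysis.
From mathcomp Require Import complex ring.

Set Implicit Arguments.
Unset Strict Implicit.
Unset Printing Implicit Defensive.

Import Order.TTheory GRing.Theory Num.Theory.
Import numFieldNormedType.Exports.

Local Open Scope classical_set_scope.
Local Open Scope ring_scope.

(* Inner products are linear in the first argument (the convention of
   [sesquilinear.v]) and norms take their values in the field, here R[i]. *)
HB.mixin Record CompleteNormedModule_isHilbert (R : realType) H
    & CompleteNormedModule R[i] H := {
  inner : {dot H for @Num.conj R[i]} ;
  innerE : forall x : H, inner x x = `|x| ^+ 2
}.

#[short(type="hilbertType")]
HB.structure Definition Hilbert (R : realType) :=
  {H of CompleteNormedModule R[i] H & CompleteNormedModule_isHilbert R H}.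

Notation "''[' x , y ]" := (inner x y) (at level 0,
  format "''[' x ,  y ]") : ring_scope.

Definition is_subspace (K : pzRingType) (V : lmodType K) (A : set V) :=
  A 0 /\ forall (a : K) (x y : V), A x -> A y -> A (a *: x + y).

Definition finite_dim (K : pzRingType) (V : lmodType K) (A : set V) :=
  exists (n : nat) (b : 'I_n -> V),
    forall x, A x -> exists c : 'I_n -> K, x = \sum_i c i *: b i.

Definition separable (T : topologicalType) :=
  exists2 D : set T, countable D & dense D.

Record closed_subspace (R : realType) (X : hilbertType R) := ClosedSubspace {
  cs_set :> set X ;
  cs_subspace : is_subspace cs_set ;
  cs_closed : closed cs_set
}.

Section SubHilbert.
Variables (R : realType) (X : hilbertType R) (Y : closed_subspace X).

Definition cs_pred : {pred X} := fun x => x \in cs_set Y.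

Fact cs_pred_submod : GRing.submod_closed cs_pred.
Proof.
split; first by rewrite -topredE /= /cs_pred in_setE; exact: (cs_subspace Y).1.
move=> a x y; rewrite -!topredE /= /cs_pred !in_setE.
exact: (cs_subspace Y).2.
Qed.

HB.instance Definition _ := GRing.isSubmodClosed.Build R[i] X cs_pred
  cs_pred_submod.

Definition sub_hilbert := {x : X | cs_pred x}.

HB.instance Definition _ := SubChoice.on sub_hilbert.
HB.instance Definition _ := [SubChoice_isSubLmodule of sub_hilbert by <:].

Definition sub_norm (x : sub_hilbert) : R[i] := `|\val x|.

Fact sub_valB (x y : sub_hilbert) : \val (x - y) = \val x - \val y.
Proof. exact: raddfB. Qed.

Fact sub_valZ (a : R[i]) (x : sub_hilbert) : \val (a *: x) = a *: \val x.
Proof. exact: linearZ. Qed.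

Fact sub_normD x y : sub_norm (x + y) <= sub_norm x + sub_norm y.
Proof. by rewrite /sub_norm raddfD; exact: ler_normD. Qed.
Fact sub_normZ (a : R[i]) x : sub_norm (a *: x) = `|a| * sub_norm x.
Proof. by rewrite /sub_norm sub_valZ normrZ. Qed.
Fact sub_norm0 x : sub_norm x = 0 -> x = 0.
Proof. by move=> /normr0_eq0 x0; apply: val_inj; rewrite x0 raddf0. Qed.

HB.instance Definition _ := @Lmodule_isNormed.Build R[i] sub_hilbert
  sub_norm sub_normD sub_normZ sub_norm0.

Fact sub_complete (F : set_system sub_hilbert) :
  ProperFilter F -> cauchy F -> cvg F.
Proof.
move=> FF /cauchy_ballP Fc.
pose G : set_system X := (\val : sub_hilbert -> X) @ F.
have GF : ProperFilter G by exact: fmap_proper_filter.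
have Gc : cauchy G.
  apply/cauchy_ballP => e e0; have := Fc e e0.
  move=> [[A B]] /= [FA FB] AB; exists (\val @` A, \val @` B) => /=.
    by split; [apply: filterS FA | apply: filterS FB] => u ?; exists u.
  move=> [_ _] /= [[a Aa <-] [b Bb <-]].
  have := AB (a, b) (conj Aa Bb); rewrite -!ball_normE /=.
  by rewrite -sub_valB.
have Gl : G --> lim G by exact: (@cauchy_cvg X G GF Gc).
move: (lim G) Gl => l Gl.
have Yl : cs_pred l.
  rewrite /cs_pred in_setE.
  have FY : \forall x \near F, cs_set Y (\val (x : sub_hilbert)).
    by apply: nearW => -[x] /=; rewrite /cs_pred in_setE.
  exact: (@closed_cvg sub_hilbert X F FF \val (cs_set Y) (@cs_closed _ _ Y) FY
    l Gl).
apply/cvg_ex; exists (Sub l Yl : sub_hilbert).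
apply/(@cvgrPdist_lt _ sub_hilbert _ _ _ idfun) => e e0.
have /cvgrPdist_lt/(_ e e0) := Gl.
apply: filterS => x; rewrite [in X in _ -> X]/Num.norm /= /sub_norm.
by rewrite sub_valB SubK.
Qed.

HB.instance Definition _ := Uniform_isComplete.Build sub_hilbert sub_complete.

Definition sub_inner (x y : sub_hilbert) : R[i] := inner (\val x) (\val y).

Fact sub_inner_zmodl y : zmod_morphism (sub_inner^~ y).
Proof. by move=> u v; rewrite /sub_inner sub_valB linearBl. Qed.
Fact sub_inner_zmodr x : zmod_morphism (sub_inner x).
Proof. by move=> u v; rewrite /sub_inner sub_valB linearBr. Qed.
Fact sub_inner_scall y : scalable_for *%R (sub_inner^~ y).
Proof. by move=> a u; rewrite /sub_inner sub_valZ linearZl_LR. Qed.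
Fact sub_inner_scalr x :
  scalable_for (@Num.conj R[i] \; *%R) (sub_inner x).
Proof. by move=> a u; rewrite /sub_inner sub_valZ linearZr_LR. Qed.
HB.instance Definition _ := isBilinear.Build R[i] sub_hilbert sub_hilbert R[i]
  _ _ sub_inner sub_inner_zmodl sub_inner_zmodr sub_inner_scall sub_inner_scalr.

Fact sub_inner_herm (x y : sub_hilbert) :
  sub_inner x y = (-1) ^+ false * Num.conj (sub_inner y x).
Proof. exact: hermC. Qed.
HB.instance Definition _ := isHermitianSesquilinear.Build R[i] sub_hilbert
  false Num.conj sub_inner sub_inner_herm.

Fact sub_innerE (x : sub_hilbert) : sub_inner x x = `|x| ^+ 2.
Proof. exact: innerE. Qed.
Fact sub_inner_gt0 (x : sub_hilbert) : x != 0 -> 0 < sub_inner x x.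
Proof. by move=> x0; rewrite sub_innerE exprn_gt0// normr_gt0. Qed.
HB.instance Definition _ := isDotProduct.Build R[i] sub_hilbert sub_inner
  sub_inner_gt0.

HB.instance Definition _ := CompleteNormedModule_isHilbert.Build R sub_hilbert
  sub_innerE.

End SubHilbert.

(* The Hilbert direct sum; the norm that the library puts on [H1 * H2] is the
   maximum of the two norms, hence the alias. *)
Section HilbertSum.
Variables (R : realType) (H1 H2 : hilbertType R).

Definition hsum := (H1 * H2)%type.

HB.instance Definition _ := GRing.Lmodule.copy hsum (H1 * H2)%type.

Definition hsum_inner (x y : hsum) : R[i] :=
  inner x.1 y.1 + inner x.2 y.2.

Definition hsum_norm (x : hsum) : R[i] :=
  sqrtC (`|x.1| ^+ 2 + `|x.2| ^+ 2).

Fact hsum_norm_ge0 x : 0 <= hsum_norm x.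
Proof. by rewrite sqrtC_ge0 addr_ge0 ?exprn_ge0. Qed.

Fact hsum_normE x : hsum_norm x ^+ 2 = `|x.1| ^+ 2 + `|x.2| ^+ 2.
Proof. exact: sqrtCK. Qed.

Fact hsum_norm_le (x : hsum) (e : R[i]) : 0 <= e ->
  (hsum_norm x <= e) = (`|x.1| ^+ 2 + `|x.2| ^+ 2 <= e ^+ 2).
Proof.
by move=> e0; rewrite -hsum_normE ler_pXn2r// nnegrE hsum_norm_ge0.
Qed.

Fact hsum_normD x y : hsum_norm (x + y) <= hsum_norm x + hsum_norm y.
Proof.
rewrite hsum_norm_le ?addr_ge0 ?hsum_norm_ge0//.
set p := hsum_norm x; set q := hsum_norm y.
have [p0 q0] : 0 <= p /\ 0 <= q by rewrite !hsum_norm_ge0.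
have pE : p ^+ 2 = `|x.1| ^+ 2 + `|x.2| ^+ 2 by exact: hsum_normE.
have qE : q ^+ 2 = `|y.1| ^+ 2 + `|y.2| ^+ 2 by exact: hsum_normE.
have [a0 [b0 [c0 d0]]] : 0 <= `|x.1| /\ 0 <= `|x.2| /\ 0 <= `|y.1|
  /\ 0 <= `|y.2| by rewrite !normr_ge0.
have n1 : `|(x + y).1| ^+ 2 <= (`|x.1| + `|y.1|) ^+ 2.
  by rewrite ler_pXn2r ?nnegrE ?addr_ge0//; exact: ler_normD.
have n2 : `|(x + y).2| ^+ 2 <= (`|x.2| + `|y.2|) ^+ 2.
  by rewrite ler_pXn2r ?nnegrE ?addr_ge0//; exact: ler_normD.
apply: (le_trans (lerD n1 n2)); move: a0 b0 c0 d0 pE qE.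
move: `|x.1| `|x.2| `|y.1| `|y.2| => a b c d a0 b0 c0 d0 pE qE.
have CS : a * c + b * d <= p * q.
  rewrite -(@ler_pXn2r _ 2)// ?nnegrE ?addr_ge0 ?mulr_ge0//.
  rewrite exprMn pE qE -subr_ge0.
  rewrite (_ : _ - _ = (a * d - b * c) ^+ 2); last by ring.
  by rewrite real_exprn_even_ge0// rpredB// rpredM// ger0_real.
rewrite !sqrrD pE qE -subr_ge0.
rewrite (_ : _ - _ = (p * q - (a * c + b * d)) *+ 2); last by ring.
by rewrite mulrn_wge0// subr_ge0.
Qed.

Fact hsum_normZ (a : R[i]) x : hsum_norm (a *: x) = `|a| * hsum_norm x.
Proof.
apply: (@pexpIrn _ 2); rewrite ?nnegrE ?mulr_ge0 ?hsum_norm_ge0//.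
by rewrite hsum_normE exprMn hsum_normE !normrZ !exprMn mulrDr.
Qed.

Fact hsum_norm0 x : hsum_norm x = 0 -> x = 0.
Proof.
move=> /eqP; rewrite sqrtC_eq0 paddr_eq0 ?exprn_ge0// !expf_eq0 /= !normr_eq0.
by case: x => u v /= /andP[/eqP-> /eqP->].
Qed.

HB.instance Definition _ := @Lmodule_isNormed.Build R[i] hsum
  hsum_norm hsum_normD hsum_normZ hsum_norm0.

Fact hsum_fst_le (x : hsum) : `|x.1| <= `|x|.
Proof.
rewrite -(@ler_pXn2r _ 2)// ?nnegrE// [`|x|]/(hsum_norm x) hsum_normE.
by rewrite lerDl exprn_ge0.
Qed.

Fact hsum_snd_le (x : hsum) : `|x.2| <= `|x|.
Proof.
rewrite -(@ler_pXn2r _ 2)// ?nnegrE// [`|x|]/(hsum_norm x) hsum_normE.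
by rewrite lerDr exprn_ge0.
Qed.

Fact hsum_le (x : hsum) : `|x| <= `|x.1| + `|x.2|.
Proof.
rewrite [`|x|]/(hsum_norm x) hsum_norm_le ?addr_ge0//.
by rewrite sqrrD addrAC lerDl mulrn_wge0// mulr_ge0.
Qed.

Fact hsum_complete (F : set_system hsum) :
  ProperFilter F -> cauchy F -> cvg F.
Proof.
move=> FF /cauchy_ballP Fc.
have cproj (H : hilbertType R) (f : hsum -> H) :
    (forall x y, `|f x - f y| <= `|x - y|) -> exists l : H, f @ F --> l.
  move=> fle; pose G : set_system H := f @ F.
  have GF : ProperFilter G by exact: fmap_proper_filter.
  have Gc : cauchy G.
    apply/cauchy_ballP => e e0; have := Fc e e0.
    move=> [[A B]] /= [FA FB] AB; exists (f @` A, f @` B) => /=.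
      by split; [apply: filterS FA | apply: filterS FB] => u ?; exists u.
    move=> [_ _] /= [[a Aa <-] [b Bb <-]].
    have := AB (a, b) (conj Aa Bb); rewrite -!ball_normE /=.
    exact/le_lt_trans/fle.
  by exists (lim G); exact: (@cauchy_cvg H G GF Gc).
have [l1 Fl1] := cproj H1 fst (fun x y => hsum_fst_le (x - y)).
have [l2 Fl2] := cproj H2 snd (fun x y => hsum_snd_le (x - y)).
apply/cvg_ex; exists ((l1, l2) : hsum).
apply/(@cvgrPdist_lt _ hsum _ _ _ idfun) => e e0.
have /cvgrPdist_lt/(_ (e / 2) (divr_gt0 e0 (ltr0Sn _ 1))) F1 := Fl1.
have /cvgrPdist_lt/(_ (e / 2) (divr_gt0 e0 (ltr0Sn _ 1))) F2 := Fl2.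
apply: filterS2 F1 F2 => x x1 x2.
apply: (le_lt_trans (hsum_le _)); rewrite (splitr e); exact: ltrD.
Qed.

HB.instance Definition _ := Uniform_isComplete.Build hsum hsum_complete.

Fact hsum_inner_zmodl y : zmod_morphism (hsum_inner^~ y).
Proof. by move=> u v; rewrite /hsum_inner !linearBl opprD addrACA. Qed.
Fact hsum_inner_zmodr x : zmod_morphism (hsum_inner x).
Proof. by move=> u v; rewrite /hsum_inner !linearBr opprD addrACA. Qed.
Fact hsum_inner_scall y : scalable_for *%R (hsum_inner^~ y).
Proof. by move=> a u; rewrite /hsum_inner !linearZl_LR -mulrDr. Qed.
Fact hsum_inner_scalr x :
  scalable_for (@Num.conj R[i] \; *%R) (hsum_inner x).
Proof. by move=> a u; rewrite /hsum_inner !linearZr_LR /= -mulrDr. Qed.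
HB.instance Definition _ := isBilinear.Build R[i] hsum hsum R[i]
  _ _ hsum_inner hsum_inner_zmodl hsum_inner_zmodr hsum_inner_scall
  hsum_inner_scalr.

Fact hsum_inner_herm (x y : hsum) :
  hsum_inner x y = (-1) ^+ false * Num.conj (hsum_inner y x).
Proof.
by rewrite /hsum_inner rmorphD /= mulrDr; congr (_ + _); exact: hermC.
Qed.
HB.instance Definition _ := isHermitianSesquilinear.Build R[i] hsum
  false Num.conj hsum_inner hsum_inner_herm.

Fact hsum_innerE (x : hsum) : hsum_inner x x = `|x| ^+ 2.
Proof. by rewrite [`|x|]/(hsum_norm x) hsum_normE -!innerE. Qed.
Fact hsum_inner_gt0 (x : hsum) : x != 0 -> 0 < hsum_inner x x.
Proof. by move=> x0; rewrite hsum_innerE exprn_gt0// normr_gt0. Qed.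
HB.instance Definition _ := isDotProduct.Build R[i] hsum hsum_inner
  hsum_inner_gt0.

HB.instance Definition _ := CompleteNormedModule_isHilbert.Build R hsum
  hsum_innerE.

End HilbertSum.

Section UnboundedOperators.
Variables (R : realType) (X : hilbertType R).

(* A partially defined operator; its values off the domain are irrelevant. *)
Record operator := Operator {
  dom : set X ;
  op_fun :> X -> X
}.

Definition linear_op (E : operator) :=
  is_subspace (dom E) /\
  forall (a : R[i]) (f g : X), dom E f -> dom E g ->
    E (a *: f + g) = a *: E f + E g.

Definition closed_op (E : operator) :=
  closed [set (f, E f) | f in dom E].

Definition densely_defined (E : operator) := dense (dom E).

Definition symmetric_op (E : operator) :=
  forall f g, dom E f -> dom E g -> '[E f, g] = '[f, E g].

Definition op_range (E : operator) (z : R[i]) : set X :=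
  [set E f - z *: f | f in dom E].

(* [adjoint_graph E f h] : [f] is in the domain of E^* and [E^* f = h]. *)
Definition adjoint_graph (E : operator) (f h : X) :=
  forall g, dom E g -> '[E g, f] = '[g, h].

Definition selfadjoint (E : operator) :=
  densely_defined E /\
  forall f h, adjoint_graph E f h <-> dom E f /\ E f = h.

(* The orthogonal complement of rng (E - z I), i.e. the kernel of
   E^* - conj(z) I. *)
Definition defect_space (E : operator) (z : R[i]) : set X :=
  [set h | forall g, op_range E z g -> '[g, h] = 0].

Definition infinite_deficiency_indices (E : operator) :=
  ~ finite_dim (defect_space E 'i) /\ ~ finite_dim (defect_space E (- 'i)).

Definition ortho_proj (L : closed_subspace X) (f : X) : sub_hilbert L :=
  xget 0 [set y : sub_hilbert L | forall l, cs_set L l -> '[f - \val y, l] = 0].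

End UnboundedOperators.

Section Simple.
Variables (R : realType) (X : hilbertType R).

Definition reducing (E : operator X) (L : closed_subspace X) :=
  forall f, dom E f -> dom E (\val (ortho_proj L f)) /\
    E (\val (ortho_proj L f)) = \val (ortho_proj L (E f)).

(* The part of [E] in a reducing subspace [L]; as [E] maps [dom E] meet [L]
   to [L], the projection only retypes the values. *)
Definition part (E : operator X) (L : closed_subspace X) :
    operator (sub_hilbert L) :=
  Operator [set f : sub_hilbert L | dom E (\val f)]
    (fun f : sub_hilbert L => ortho_proj L (E (\val f))).

Definition simple_op (E : operator X) :=
  ~ exists L : closed_subspace X,
      [/\ reducing E L, exists2 f, cs_set L f & f != 0 & selfadjoint (part E L)].

End Simple.

Section Model.
Variables (R : realType) (X : hilbertType R).
Variables (E : operator X) (Y : closed_subspace X).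

Definition regular_point (z : R[i]) :=
  [/\ closed (op_range E z),
      forall f, op_range E z f -> cs_set Y f -> f = 0 &
      forall f, exists m y, [/\ op_range E z m, cs_set Y y & f = m + y]].

(* At a regular point of a simple operator, the value and the preimage chosen
   by [xget] below are unique; the default 0 is never used. *)
Definition PY (z : R[i]) (f : X) : sub_hilbert Y :=
  xget 0 [set y : sub_hilbert Y | op_range E z (f - \val y)].

Definition tauY (z : R[i]) (f : X) : X :=
  xget 0 [set g | dom E g /\ E g - z *: g = f - \val (PY z f)].

End Model.

(* A space of [K]-valued functions on [Om] together with an inner product; the
   inner product is meaningful only on the members of the space. *)
Record function_space (R : realType) (Om : set R[i]^o) (K : hilbertType R) :=
  FunctionSpace {
    fs_set : set (Om -> K) ;
    fs_inner : (Om -> K) -> (Om -> K) -> R[i]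
  }.

Section FunctionSpaces.
Variables (R : realType) (Om : set R[i]^o) (K : hilbertType R).

(* ['valL_ 0 f] extends [f] by 0; for open [Om] the values off [Om] do not
   affect the derivatives on [Om]. *)
Definition analytic_fun (f : Om -> K) :=
  forall z : R[i]^o, Om z -> derivable ('valL_ 0 f : R[i]^o -> K) z 1.

Definition hilbert_function_space (F : function_space Om K) :=
  let S := fs_set F in let ip := fs_inner F in
  [/\ is_subspace S,
      forall (a : R[i]) f g h, S f -> S g -> S h ->
        ip (a *: f + g) h = a * ip f h + ip g h,
      forall f g, S f -> S g -> ip f g = (ip g f)^*,
      forall f, S f -> f != 0 -> 0 < ip f f &
      forall u : nat -> (Om -> K), (forall n, S (u n)) ->
        (forall e : R[i], 0 < e -> exists N : nat, forall m n : nat,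
          (N <= m)%N -> (N <= n)%N -> ip (u m - u n) (u m - u n) < e) ->
        exists2 f, S f &
          forall e : R[i], 0 < e -> exists N : nat, forall n : nat,
            (N <= n)%N -> ip (u n - f) (u n - f) < e].

(* [k w z] is the value K_w(z) of the kernel. *)
Definition positive_kernel (k : R[i] -> R[i] -> K -> K) :=
  forall (n : nat) (w : 'I_n -> Om) (u : 'I_n -> K),
    0 <= \sum_i \sum_j '[k (\val (w j)) (\val (w i)) (u j), u i].

Definition is_RKHS (k : R[i] -> R[i] -> K -> K) (F : function_space Om K) :=
  [/\ hilbert_function_space F,
      forall f, fs_set F f -> analytic_fun f,
      forall (w : Om) (u : K), fs_set F (fun z : Om => k (\val w) (\val z) u) &
      forall (w : Om) (u : K) (f : Om -> K), fs_set F f ->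
        fs_inner F f (fun z : Om => k (\val w) (\val z) u) = '[f w, u]].

End FunctionSpaces.

Section BoundedOperators.
Variables (R : realType) (K : hilbertType R).

Definition bounded_op (T : K -> K) :=
  linear T /\ exists M : R[i], forall u, `|T u| <= M * `|u|.

Definition adjoint (T : K -> K) (v : K) : K :=
  xget 0 [set w | forall u, '[T u, v] = '[u, w]].

Definition compact_op (T : K -> K) :=
  bounded_op T /\ precompact (T @` [set u | `|u| <= 1]).

Definition is_signature (J : K -> K) :=
  [/\ bounded_op J, forall u v, '[J u, v] = '[u, J v],
      forall u v, '[J u, J v] = '[u, v] & forall v, exists u, J u = v].

(* [D] is the derivative at [z] of the operator valued function [U], in the
   operator norm. *)
Definition is_op_derive (U : R[i] -> K -> K) (z : R[i]) (D : K -> K) :=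
  bounded_op D /\
  forall e : R[i], 0 < e -> \forall h \near (0 : R[i]^o)^',
    forall u : K, `|h^-1 *: (U (z + h) u - U z u) - D u| <= e * `|u|.

Definition op_derive (U : R[i] -> K -> K) (z : R[i]) : K -> K :=
  xget (fun=> 0) [set D | is_op_derive U z D].

Definition admissible (Om : set R[i]^o) (J : K -> K) (U : R[i] -> K -> K) :=
  [/\ forall z, Om z -> bounded_op (U z),
      forall z, Om z -> exists D, is_op_derive U z D,
      forall z, Om z -> forall u, U z (J (adjoint (U z^*) u)) = J u &
      forall z, Om z -> forall u, adjoint (U z^*) (J (U z u)) = J u].

Definition rho (w z : R[i]) : R[i] := - (2 * (pi%:C)%C * 'i * (z - w^*)).

Definition KU (J : K -> K) (U : R[i] -> K -> K) (w z : R[i]) (u : K) : K :=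
  if z == w^*
  then (2 * (pi%:C)%C * 'i)^-1 *: op_derive U z (J (adjoint (U w) u))
  else (rho w z)^-1 *: (J u - U z (J (adjoint (U w) u))).

(* A reproducing kernel determines its Hilbert space, members and inner product
   alike, so this says that [F] is H(U). *)
Definition is_HU (Om : set R[i]^o) (J : K -> K) (U : R[i] -> K -> K)
    (F : function_space Om K) :=
  positive_kernel Om (KU J U) /\ is_RKHS (KU J U) F.

Definition is_H0U (Om : set R[i]^o) (J : K -> K) (F : function_space Om K) :=
  is_signature J /\
  exists U : R[i] -> K -> K,
    [/\ admissible Om J U, is_HU J U F &
        forall z, Om z -> ~ compact_op (fun u => u - U z u)].

End BoundedOperators.

Section H2.
Variables (R : realType) (X : hilbertType R).
Variables (E : operator X) (Y : closed_subspace X) (Om : set R[i]^o).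

Definition YY : hilbertType R := hsum (sub_hilbert Y) (sub_hilbert Y).

Definition H2_map (f : X) : Om -> YY := fun z =>
  (PY E Y (\val z) f,
   ((pi%:C)%C * 'i)^-1 *: ortho_proj Y (tauY E Y (\val z) f)).

(* The inner product is carried over from [X] through the preimages by
   [H2_map], which are unique as [H2_map] is injective. *)
Definition H2 : function_space Om YY :=
  FunctionSpace (range H2_map)
    (fun F G => 2 * '[xget 0 [set f | H2_map f = F],
                      xget 0 [set g | H2_map g = G]]).

Definition J1 (u : YY) : YY := (u.2, u.1).

End H2.

(* Main.v *)
(** Write [Gam z : X -> Y + Y] for the evaluation [f |-> (f_Y(z), f~_Y(z))] and
put N(l, w) = J + pi i (l - conj w) Gam(l) Gam(w)^*.  The resolvent identities for
P_Y and tau_Y, together with the Green formula for [J Gam(m), Gam(w)], give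
N(l, conj m) J N(m, w) = N(l, w).  Hence, if C J C^* = N(m, m) for one m in Om
and one injective C, then U(z) = N(z, conj m) J C satisfies
U(l) J U(w)^* = N(l, w), so that K^U_w(z) = Gam(z) Gam(w)^* / 2 is the kernel
of H_2.

For Im m > 0 the factorization is a block LDL^* decomposition: the (1,1) blocks
of N(m, m) and of N(conj m, conj m) are -a and e with a, e > 0, and the Schur
complement of -a in N(m, m) is e^-1, so that only the inverse square roots of
a and e are needed.

The operator C may be multiplied on the right by a J-unitary shear
V = [[1, 0], [i A, 1]] with A self-adjoint.  Compactness of I - U(z) would force
i A to agree, modulo compact operators, with a corner of the inverse of
N(z, conj m) J C, which is norm continuous in z; diagonalizing over a countable dense
set of points z, one finds a projection A that does so for no z in Om.

Injectivity of f |-> Gam(.) f comes from simplicity: the closed subspace of all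
f with P_Y(z) f = 0 on Om is invariant under every tau_Y(z), hence reduces E to
a self-adjoint operator. *)

From HB Require Import structures.
Require Import Defs.
From mathcomp Require Import all_boot all_order all_algebra.
From mathcomp Require Import all_classical all_reals all_analysis.
From mathcomp Require Import complex ring lra.

Import Order.TTheory GRing.Theory Num.Theory.
Import numFieldNormedType.Exports.

Set Implicit Arguments.
Unset Strict Implicit.
Unset Printing Implicit Defensive.

Local Open Scope classical_set_scope.
Local Open Scope ring_scope.

(** * Real-valued norms and inner products *)

(** The 1/2 in the kernel compensates the factor 2 in the inner product of H_2, and the 1/(pi i) in
    the second component of Gam(z) is what turns the Green formula into the denominator -2 pi i (l -
    conj w). A vector y of Y satisfies Gam(z) y = (y, 0) at every z, so the (1,1) block of Gam(z)
    Gam(z)^* is at least the identity: this is where the positivity of a and e comes from. The Schur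
    complement is read off from N(conj m, conj m) J N(m, m) = J, and the signs of -a and e^-1 are
    matched with the negative and positive parts of J. At a real m there is nothing to factor, as
    N(m, m) = J. A single shear has to defeat compactness at uncountably many z. Since a J-unitary
    factor on the right of C does not change C J C^*, the kernel is unaffected and A is free. A gap
    of 1/2 between A and the corner at one point of a countable dense set survives as a gap of 1/4
    at all nearby z. *)

Section RealNorm.
Context {R : realType}.

(* The library norm takes its values in R[i]; the real-valued copy makes the
   decision procedures for ordered fields available. *)
Definition rn {V : normedZmodType R[i]} (x : V) : R := complex.Re `|x|.

Lemma rnE (V : normedZmodType R[i]) (x : V) : `|x| = (rn x)%:C%C.
Proof. by rewrite /rn RRe_real// normr_real. Qed.

Lemma rn_ge0 (V : normedZmodType R[i]) (x : V) : 0 <= rn x.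
Proof. by rewrite -ler0c -rnE. Qed.

Lemma rn0 (V : normedZmodType R[i]) : rn (0 : V) = 0.
Proof. by rewrite /rn normr0. Qed.

Lemma rn_eq0 (V : normedZmodType R[i]) (x : V) : rn x = 0 -> x = 0.
Proof. by move=> x0; apply/eqP; rewrite -normr_eq0 rnE x0. Qed.

Lemma rn_gt0 (V : normedZmodType R[i]) (x : V) : x != 0 -> 0 < rn x.
Proof.
move=> x0; rewrite lt_neqAle rn_ge0 andbT; apply: contra x0 => /eqP x0.
by apply/eqP/rn_eq0.
Qed.

Lemma rnN (V : normedZmodType R[i]) (x : V) : rn (- x) = rn x.
Proof. by rewrite /rn normrN. Qed.

Lemma rnBC (V : normedZmodType R[i]) (x y : V) : rn (x - y) = rn (y - x).
Proof. by rewrite -rnN opprB. Qed.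

Lemma rnD (V : normedZmodType R[i]) (x y : V) : rn (x + y) <= rn x + rn y.
Proof. by rewrite -lecR rmorphD /= -!rnE ler_normD. Qed.

Lemma rnB (V : normedZmodType R[i]) (x y : V) : rn (x - y) <= rn x + rn y.
Proof. by rewrite -(rnN y) rnD. Qed.

Lemma rn_dist (V : normedZmodType R[i]) (x y : V) : rn x <= rn y + rn (x - y).
Proof. by rewrite -{1}(subrK y x) addrC rnD. Qed.

Lemma rn_dist3 (V : normedZmodType R[i]) (x y z : V) :
  rn (x - z) <= rn (x - y) + rn (y - z).
Proof. by rewrite -{1}(subrK y x) -addrA rnD. Qed.

Lemma rnZ (V : normedModType R[i]) (a : R[i]) (x : V) :
  rn (a *: x) = rn a * rn x.
Proof.
by apply: (@complexI R); rewrite rmorphM /= -!rnE normrZ.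
Qed.

Lemma rnM (a b : R[i]) : rn (a * b) = rn a * rn b.
Proof. by apply: (@complexI R); rewrite rmorphM /= -!rnE normrM. Qed.

Lemma rnV (a : R[i]) : rn a^-1 = (rn a)^-1.
Proof. by apply: (@complexI R); rewrite fmorphV /= -!rnE normfV. Qed.

Lemma rnC (r : R) : rn (r%:C)%C = `|r|.
Proof.
by rewrite /rn normc_def /= expr0n addr0 sqrtr_sqr.
Qed.

Lemma rn_conj (a : R[i]) : rn a^* = rn a.
Proof. by rewrite /rn norm_conjC. Qed.

Lemma gt0_real_complex (e : R[i]) : 0 < e -> exists2 r : R, 0 < r & e = (r%:C)%C.
Proof.
move=> e0; have e1 : e = ((complex.Re e)%:C)%C by rewrite RRe_real// gtr0_real.
by exists (complex.Re e) => //; rewrite -ltcR -e1.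
Qed.

Lemma rn_cvgP (V : normedModType R[i]) (T : Type) (F : set_system T)
    (FF : Filter F) (f : T -> V) (l : V) :
  f @ F --> l <-> forall e : R, 0 < e -> \forall x \near F, rn (f x - l) < e.
Proof.
split=> [/cvgrPdist_lt Fl e e0|Fl].
  have := Fl (e%:C)%C; rewrite ltcR => /(_ e0); apply: filterS => x.
  by rewrite distrC rnE ltcR.
apply/cvgrPdist_lt => _ /gt0_real_complex[e e0 ->].
by have := Fl e e0; apply: filterS => x; rewrite distrC rnE ltcR.
Qed.

Lemma rn_cvg_seqP (V : normedModType R[i]) (u : nat -> V) (l : V) :
  u @ \oo --> l <->
  forall e : R, 0 < e -> exists N : nat, forall n, (N <= n)%N -> rn (u n - l) < e.
Proof.
split=> [/rn_cvgP ul e /ul[N _ NP]|ul]; first by exists N => n; exact: NP.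
by apply/rn_cvgP => e /ul[N NP]; exists N => // n; exact: NP.
Qed.

Lemma rn_cauchy_cvg (V : completeNormedModType R[i]) (u : nat -> V) :
  (forall e : R, 0 < e -> exists N : nat, forall m n,
    (N <= m)%N -> (N <= n)%N -> rn (u m - u n) < e) ->
  exists l : V, u @ \oo --> l.
Proof.
move=> uc; exists (lim (u @ \oo)).
apply: (@cauchy_cvg V (u @ \oo)).
apply/cauchy_ballP => _ /gt0_real_complex[e e0 ->].
have [N NP] := uc e e0.
exists ([set u n | n in [set n | (N <= n)%N]], [set u n | n in [set n | (N <= n)%N]]).
  by split=> /=; exists N => // n /= Nn; exists n.
move=> [_ _] /= [[m Nm <-] [n Nn <-]]; rewrite -ball_normE /=.
by rewrite rnE ltcR NP.
Qed.

Lemma geo_lt (t c e : R) : 0 <= t < 1 -> 0 <= c -> 0 < e ->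
  exists N : nat, forall n, (N <= n)%N -> c * t ^+ n < e.
Proof.
move=> /andP[t0 t1] c0 e0.
have /cvgrPdist_lt/(_ (e / (c + 1))) : (fun n => t ^+ n) @ \oo --> (0 : R).
  by apply: cvg_expr; rewrite ger0_norm.
case=> [|N _ NP]; first by rewrite divr_gt0// ltr_wpDl.
exists N => n Nn; have := NP n Nn; rewrite /= sub0r normrN ger0_norm ?exprn_ge0//.
rewrite ltr_pdivlMr ?ltr_wpDl// => /le_lt_trans; apply.
by rewrite mulrC ler_wpM2l ?exprn_ge0// lerDl.
Qed.

Lemma geo_cvg (V : completeNormedModType R[i]) (u : nat -> V) (c t : R) :
  0 <= t < 1 -> (forall n, rn (u n.+1 - u n) <= c * t ^+ n) ->
  exists2 l : V, u @ \oo --> l & forall n, rn (u n - l) <= c * t ^+ n / (1 - t).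
Proof.
move=> tb uc; have /andP[t0 t1] := tb.
have c0 : 0 <= c by have := uc 0%N; rewrite expr0 mulr1; apply/le_trans/rn_ge0.
have t1' : 0 < 1 - t by rewrite subr_gt0.
have ut n k : rn (u (n + k)%N - u n) <= c * t ^+ n / (1 - t).
  (* Keeping the factor [1 - t ^+ k] of the geometric sum makes the induction on [k] close. *)
  have : rn (u (n + k)%N - u n) <= c * t ^+ n * (1 - t ^+ k) / (1 - t).
    elim: k => [|k IH]; first by rewrite addn0 subrr rn0 expr0 subrr mulr0 mul0r.
    apply: (le_trans (rn_dist3 _ (u (n + k)%N) _)); rewrite addnS.
    apply: (le_trans (lerD (uc _) IH)).
    rewrite ler_pdivlMr// mulrDl divfK ?gt_eqF//.
    by rewrite exprD exprS; lra.
  move=> /le_trans; apply; rewrite ler_pM2r ?invr_gt0//.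
  by rewrite ler_piMr ?mulr_ge0 ?exprn_ge0// lerBlDr lerDl exprn_ge0.
have [l ul] : exists l : V, u @ \oo --> l.
  apply: rn_cauchy_cvg => e e0.
  have [N NP] := @geo_lt t (c / (1 - t)) (e / 2) tb (divr_ge0 c0 (ltW t1'))
    (divr_gt0 e0 (ltr0Sn _ 1)).
  exists N => m n Nm Nn.
  apply: (le_lt_trans (rn_dist3 _ (u N) _)); rewrite (rnBC (u N)).
  have := NP N (leqnn N); have := ut N (m - N)%N; have := ut N (n - N)%N.
  by rewrite !subnKC// mulrAC; lra.
exists l => // n; apply/ler_addgt0Pr => e e0.
have /rn_cvg_seqP/(_ e e0)[N NP] := ul.
apply: (le_trans (rn_dist3 _ (u (n + N)%N) _)); rewrite rnBC lerD ?ut//.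
by apply/ltW/NP; rewrite leq_addl.
Qed.

Lemma closed_seq (V : normedModType R[i]) (A : set V) (u : nat -> V) (l : V) :
  closed A -> (forall n, A (u n)) -> u @ \oo --> l -> A l.
Proof.
by move=> Ac uA; apply: (closed_cvg A Ac); apply: nearW.
Qed.

Lemma rn_closureP (V : normedModType R[i]) (A : set V) (x : V) :
  closure A x <-> forall e : R, 0 < e -> exists2 y, A y & rn (y - x) < e.
Proof.
split=> [cA e e0|cA].
  have e0' : 0 < (e%:C)%C by rewrite ltcR.
  have [y [Ay]] := cA _ (nbhsx_ballx x _ e0').
  rewrite -ball_normE /= rnE ltcR rnBC => ye; by exists y.
move=> B /nbhs_ballP[_ /gt0_real_complex[e e0 ->] eB].
have [y Ay ye] := cA e e0; exists y; split=> //; apply: eB.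
by rewrite -ball_normE /= rnE ltcR rnBC.
Qed.

Lemma rn_dense (V : normedModType R[i]) (A : set V) :
  (forall (x : V) (e : R), 0 < e -> exists2 y, A y & rn (y - x) < e) -> dense A.
Proof.
move=> dA B [x Bx] oB.
have /nbhs_ballP[_ /gt0_real_complex[e e0 ->] eB] : nbhs x B by exact: open_nbhs_nbhs.
have [y Ay ye] := dA x e e0; exists y; split=> //; apply: eB.
by rewrite -ball_normE /= rnE ltcR rnBC.
Qed.

End RealNorm.

Section InnerProduct.
Context {R : realType}.
Implicit Types H : hilbertType R.

Lemma ipDl H (x y z : H) : '[x + y, z] = '[x, z] + '[y, z].
Proof. exact: linearDl. Qed.
Lemma ipDr H (x y z : H) : '[x, y + z] = '[x, y] + '[x, z].
Proof. exact: linearDr. Qed.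
Lemma ipBl H (x y z : H) : '[x - y, z] = '[x, z] - '[y, z].
Proof. exact: linearBl. Qed.
Lemma ipBr H (x y z : H) : '[x, y - z] = '[x, y] - '[x, z].
Proof. exact: linearBr. Qed.
Lemma ipZl H (a : R[i]) (x y : H) : '[a *: x, y] = a * '[x, y].
Proof. exact: linearZl_LR. Qed.
Lemma ipZr H (a : R[i]) (x y : H) : '[x, a *: y] = a^* * '[x, y].
Proof. exact: linearZr_LR. Qed.
Lemma ip0l H (x : H) : '[0, x] = 0. Proof. exact: linear0l. Qed.
Lemma ip0r H (x : H) : '[x, 0] = 0. Proof. exact: linear0r. Qed.
Lemma ipNl H (x y : H) : '[- x, y] = - '[x, y]. Proof. exact: linearNl. Qed.
Lemma ipNr H (x y : H) : '[x, - y] = - '[x, y]. Proof. exact: linearNr. Qed.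
Lemma ip_suml H (I : Type) (r : seq I) (P : pred I) (F : I -> H) (y : H) :
  '[\sum_(i <- r | P i) F i, y] = \sum_(i <- r | P i) '[F i, y].
Proof. exact: linear_sumlz. Qed.
Lemma ip_sumr H (I : Type) (r : seq I) (P : pred I) (F : I -> H) (y : H) :
  '[y, \sum_(i <- r | P i) F i] = \sum_(i <- r | P i) '[y, F i].
Proof. exact: linear_sumr. Qed.

Lemma ipC H (x y : H) : '[x, y] = '[y, x]^*.
Proof. by rewrite [LHS]hermC expr0 mul1r. Qed.

Lemma ipxx H (x : H) : '[x, x] = (rn x ^+ 2)%:C%C.
Proof. by rewrite innerE rnE rmorphXn. Qed.

Lemma ip_eq0C H (x y : H) : '[x, y] = 0 -> '[y, x] = 0.
Proof. by move=> xy; rewrite ipC xy conjC0. Qed.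

Lemma ip_eq0 H (x : H) : (forall y, '[x, y] = 0) -> x = 0.
Proof.
move=> /(_ x) /eqP; rewrite innerE expf_eq0 /= normr_eq0 => /eqP//.
Qed.

Lemma ip_inj H (x y : H) : (forall z, '[x, z] = '[y, z]) -> x = y.
Proof.
by move=> xy; apply/eqP; rewrite -subr_eq0; apply/eqP/ip_eq0 => z; rewrite ipBl xy subrr.
Qed.

Lemma ip_injr H (x y : H) : (forall z, '[z, x] = '[z, y]) -> x = y.
Proof. by move=> xy; apply: ip_inj => z; rewrite ipC xy -ipC. Qed.

Lemma Re_conj (a : R[i]) : complex.Re a^* = complex.Re a.
Proof. by case: a. Qed.

Lemma ReD (a b : R[i]) : complex.Re (a + b) = complex.Re a + complex.Re b.
Proof. by case: a; case: b. Qed.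

Lemma ReN (a : R[i]) : complex.Re (- a) = - complex.Re a.
Proof. by case: a. Qed.

Lemma ReCM (r : R) (a : R[i]) : complex.Re ((r%:C)%C * a) = r * complex.Re a.
Proof. by case: a => a b /=; rewrite mul0r subr0. Qed.

Lemma rn_sqrD H (x y : H) :
  rn (x + y) ^+ 2 = rn x ^+ 2 + rn y ^+ 2 + 2 * complex.Re '[x, y].
Proof.
have := ipxx (x + y); rewrite ipDl !ipDr !ipxx (ipC y x).
move=> /(congr1 (@complex.Re R)); rewrite !ReD Re_conj /= => <-; ring.
Qed.

Lemma rn_sqrB H (x y : H) :
  rn (x - y) ^+ 2 = rn x ^+ 2 + rn y ^+ 2 - 2 * complex.Re '[x, y].
Proof. by rewrite rn_sqrD ipNr ReN rnN mulrN. Qed.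

Lemma parallelogram H (x y : H) :
  rn (x + y) ^+ 2 + rn (x - y) ^+ 2 = 2 * (rn x ^+ 2 + rn y ^+ 2).
Proof. by rewrite rn_sqrD rn_sqrB; ring. Qed.

Lemma rn_sqrD_orth H (x y : H) : '[x, y] = 0 ->
  rn (x + y) ^+ 2 = rn x ^+ 2 + rn y ^+ 2.
Proof. by move=> xy; rewrite rn_sqrD xy /= mulr0 addr0. Qed.

Lemma normC_sqr (a : R[i]) : a * a^* = (rn a ^+ 2)%:C%C.
Proof. by rewrite -normCK rnE rmorphXn. Qed.

Lemma CD (r s : R) : ((r + s)%:C = r%:C + s%:C)%C. Proof. exact: rmorphD. Qed.
Lemma CB (r s : R) : ((r - s)%:C = r%:C - s%:C)%C. Proof. exact: rmorphB. Qed.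
Lemma CM (r s : R) : ((r * s)%:C = r%:C * s%:C)%C. Proof. exact: rmorphM. Qed.

Lemma conjCM (a b : R[i]) : (a * b)^* = a^* * b^*. Proof. exact: rmorphM. Qed.
Lemma conjCB (a b : R[i]) : (a - b)^* = a^* - b^*. Proof. exact: rmorphB. Qed.
Lemma conjC_real (r : R) : ((r%:C)%C : R[i])^* = (r%:C)%C.
Proof. by apply/eqP; rewrite eq_complex /= oppr0 !eqxx. Qed.

Lemma cauchy_schwarz H (x y : H) : rn '[x, y] <= rn x * rn y.
Proof.
have [->|/rn_gt0 y0] := eqVneq y 0; first by rewrite ip0r !rn0 mulr0.
(* This vector is the component of [x] orthogonal to [y], scaled by [rn y ^+ 2] to avoid a
   division. *)
have := ipxx ((rn y ^+ 2)%:C%C *: x - '[x, y] *: y).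
rewrite ipBl !ipBr !ipZl !ipZr (ipC y x) !ipxx conjC_real.
set c := '[x, y] => E.
have {E} : rn ((rn y ^+ 2)%:C%C *: x - c *: y) ^+ 2 =
    rn y ^+ 2 * (rn y ^+ 2 * rn x ^+ 2 - rn c ^+ 2).
  apply: (@complexI R); rewrite -E [RHS]CM CB -normC_sqr (CM (rn y ^+ 2)).
  by ring.
set z := rn (_ - _) => E.
have : 0 <= rn y ^+ 2 * (rn y ^+ 2 * rn x ^+ 2 - rn c ^+ 2) by rewrite -E sqr_ge0.
rewrite pmulr_rge0 ?exprn_gt0// subr_ge0 -exprMn mulrC.
by rewrite ler_pXn2r// ?nnegrE ?mulr_ge0 ?rn_ge0// mulrC.
Qed.

Lemma cvg_ip H (u : nat -> H) (l y : H) (a : R[i]) :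
  u @ \oo --> l -> (forall n, '[u n, y] = a) -> '[l, y] = a.
Proof.
move=> /rn_cvg_seqP ul uy; apply/eqP; rewrite -subr_eq0; apply/eqP/rn_eq0/eqP.
rewrite eq_le rn_ge0 andbT; apply/ler_addgt0Pr => e e0; rewrite add0r.
have [|N /(_ N (leqnn N)) NP] := ul (e / (rn y + 1)).
  by rewrite divr_gt0// ltr_wpDl// rn_ge0.
rewrite -(uy N) -ipBl (le_trans (cauchy_schwarz _ _))// rnBC.
move: NP; rewrite ltr_pdivlMr ?ltr_wpDl ?rn_ge0// => /ltW; apply: le_trans.
by rewrite ler_wpM2l ?rn_ge0// lerDl.
Qed.

End InnerProduct.

(** * Orthogonal projections onto closed subspaces *)

Section Projection.
Context {R : realType}.
Variable H : hilbertType R.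

Lemma subspaceD (A : set H) x y : is_subspace A -> A x -> A y -> A (x + y).
Proof. by move=> [_ AP] Ax Ay; rewrite -(scale1r x); exact: AP. Qed.

Lemma subspaceZ (A : set H) (a : R[i]) x : is_subspace A -> A x -> A (a *: x).
Proof. by move=> [A0 AP] Ax; rewrite -(addr0 (a *: x)); exact: AP. Qed.

Lemma subspaceB (A : set H) x y : is_subspace A -> A x -> A y -> A (x - y).
Proof.
by move=> sA Ax Ay; rewrite -scaleN1r; apply: subspaceD => //; exact: subspaceZ.
Qed.

(** Replacing [y] by [y + a *: l] with a = <f - y, l> / |l|^2 lowers the squared distance to [f] by
    |<f - y, l>|^2 / |l|^2, so minimality forces this amount to vanish. *)
Lemma minimizer_orth (A : set H) (f y : H) : is_subspace A -> A y ->
  (forall z, A z -> rn (f - y) <= rn (f - z)) -> forall l, A l -> '[f - y, l] = 0.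
Proof.
move=> sA Ay ymin l Al; set g := f - y; set c := '[g, l].
have [l0|/eqP l0] := eqVneq (rn l) 0; first by rewrite /c (rn_eq0 l0) ip0r.
have lp : 0 < rn l ^+ 2 by rewrite exprn_gt0// lt_neqAle rn_ge0 eq_sym andbT; apply/eqP.
pose a : R[i] := ((rn l ^- 2)%:C)%C * c.
have : rn g ^+ 2 <= rn (g - a *: l) ^+ 2.
  rewrite ler_pXn2r// ?nnegrE ?rn_ge0// /g -addrA -opprD ymin//.
  by apply: subspaceD => //; exact: subspaceZ.
rewrite rn_sqrB rnZ ipZr -/c /a conjCM conjC_real -mulrA (mulrC c^*) normC_sqr.
rewrite -CM /= rnM rnC ger0_norm ?invr_ge0 ?sqr_ge0// !exprMn.
set p := rn l in lp *; set q := rn c => le1.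
have : q ^+ 2 / p ^+ 2 <= 0.
  move: le1; rewrite (_ : _ * p ^+ 2 = q ^+ 2 / p ^+ 2); last first.
    by field; rewrite -?expf_eq0 //; move: lp; rewrite lt0r expf_eq0 => /andP[].
  by rewrite (mulrC (p ^- 2)); lra.
rewrite ler_pdivrMr// mul0r => q0.
have /eqP : q ^+ 2 = 0 by apply/eqP; rewrite eq_le q0 sqr_ge0.
by rewrite expf_eq0 /= => /eqP /rn_eq0.
Qed.

Lemma projection_ex (L : closed_subspace H) (f : H) :
  exists2 y, cs_set L y & forall l, cs_set L l -> '[f - y, l] = 0.
Proof.
have sL := cs_subspace L.
pose D : set R := [set rn (f - z) ^+ 2 | z in cs_set L].
have D0 : D !=set0 by exists (rn (f - 0) ^+ 2), 0 => //; exact: sL.1.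
have Dlb : has_lbound D by exists 0 => _ [z _ <-]; exact: sqr_ge0.
pose d := inf D.
have dP z : cs_set L z -> d <= rn (f - z) ^+ 2 by move=> Lz; apply: ge_inf => //; exists z.
have /choice[u uP] : forall n : nat, exists z, cs_set L z /\ rn (f - z) ^+ 2 < d + n.+1%:R^-1.
  move=> n; have n0 : 0 < n.+1%:R^-1 :> R by rewrite invr_gt0 ltr0n.
  have [_ [z Lz <-] zd] := inf_adherent n0 (conj D0 Dlb).
  by exists z; split.
(* Parallelogram law for [f - u m] and [f - u n]: the midpoint of [u m] and [u n] lies in [L], hence
   at squared distance at least [d] from [f]. *)
have half m n : rn (u m - u n) ^+ 2 <= 2 * (m.+1%:R^-1 + n.+1%:R^-1).
  have := parallelogram (f - u m) (f - u n).
  have -> : f - u m - (f - u n) = u n - u m by rewrite addrC opprB addrA subrK.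
  have -> : f - u m + (f - u n) = 2 *: (f - 2^-1 *: (u m + u n)).
    rewrite scalerBr scalerA divff// scale1r opprD addrACA.
    by rewrite -(mulr2n f) -scaler_nat.
  have rn2 : rn (2 : R[i]) = 2 by rewrite -(rmorph_nat (@real_complex R)) rnC ger0_norm.
  rewrite rnZ exprMn (rnBC (u n)) rn2.
  have := dP _ (subspaceZ 2^-1 sL (subspaceD sL (uP m).1 (uP n).1)).
  have := (uP m).2; have := (uP n).2.
  move: (m.+1%:R^-1) (n.+1%:R^-1) (rn (_ - _ *: _)) => a b q; rewrite expr2; lra.
have [l ul] : exists l : H, u @ \oo --> l.
  apply: (@rn_cauchy_cvg _ H) => e e0.
  have e4 : 0 < e ^+ 2 / 4 by rewrite divr_gt0 ?exprn_gt0.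
  have [N NP] : exists N : nat, N.+1%:R^-1 < e ^+ 2 / 4.
    by have [N] := @ltr_add_invr R 0 _ e4; rewrite add0r => NP; exists N.
  exists N => m n Nm Nn; rewrite -(@ltr_pXn2r _ 2)// ?nnegrE ?rn_ge0 ?ltW//.
  apply: (le_lt_trans (half m n)).
  have leN k : (N <= k)%N -> k.+1%:R^-1 <= N.+1%:R^-1 :> R.
    by move=> Nk; rewrite lef_pV2 ?posrE ?ltr0n// ler_nat ltnS.
  move: NP (leN m Nm) (leN n Nn).
  by move: (m.+1%:R^-1) (n.+1%:R^-1) (N.+1%:R^-1) => a b c; lra.
have Ll : cs_set L l by apply: closed_seq ul => [|n]; [exact: cs_closed|exact: (uP n).1].
exists l => //; apply: minimizer_orth => // z Lz.
apply/ler_addgt0Pr => e e0; move/rn_cvg_seqP : ul => /(_ (e / 2)).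
case=> [|N1 N1P]; first by lra.
have e2 : 0 < (e / 2) ^+ 2 by rewrite exprn_gt0//; lra.
have [N2 N2P] := @ltr_add_invr R 0 _ e2.
set n := maxn N1 N2; have := N1P n (leq_maxl _ _).
have fz : rn (f - u n) <= rn (f - z) + e / 2.
  rewrite -(@ler_pXn2r _ 2)// ?nnegrE ?addr_ge0 ?rn_ge0//; last by lra.
  apply: (le_trans (ltW (uP n).2)); rewrite sqrrD.
  have : n.+1%:R^-1 <= N2.+1%:R^-1 :> R.
    by rewrite lef_pV2 ?posrE ?ltr0n// ler_nat ltnS leq_maxr.
  have : 0 <= rn (f - z) * (e / 2) by rewrite mulr_ge0 ?rn_ge0//; lra.
  move: N2P (dP z Lz); rewrite add0r.
  by move: (n.+1%:R^-1) (N2.+1%:R^-1) => a b; lra.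
by have := rn_dist3 f (u n) l; lra.
Qed.

Lemma ortho_projP (L : closed_subspace H) (f l : H) :
  cs_set L l -> '[f - \val (ortho_proj L f), l] = 0.
Proof.
move: l; rewrite /ortho_proj; case: xgetP => [y -> //|noy].
have [y Ly yP] := projection_ex L f.
have Py : cs_pred L y by rewrite /cs_pred in_setE.
by have := noy (Sub y Py : sub_hilbert L); case=> l Ll; exact: yP.
Qed.

Lemma cs_valP (L : closed_subspace H) (y : sub_hilbert L) : cs_set L (\val y).
Proof. by have := valP y; rewrite /cs_pred in_setE. Qed.

Lemma ortho_proj_unique (L : closed_subspace H) (f : H) (y : sub_hilbert L) :
  (forall l, cs_set L l -> '[f - \val y, l] = 0) -> ortho_proj L f = y.
Proof.
move=> fy; apply: val_inj; set z : H := \val (ortho_proj L f) - \val y.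
suff : z = 0 by move/eqP; rewrite subr_eq0 => /eqP.
have Lz : cs_set L z by apply: subspaceB; [exact: cs_subspace|exact: cs_valP..].
have zE : f - \val y - (f - \val (ortho_proj L f)) = z.
  by rewrite addrC opprB addrA subrK.
have zz : '[z, z] = 0 by rewrite -{1}zE ipBl (fy _ Lz) (ortho_projP _ Lz) subrr.
by apply: rn_eq0; apply/eqP; rewrite -sqrf_eq0 -(inj_eq (@complexI R)) -ipxx zz.
Qed.

(** The residual of the projection of [x] onto the closure of [A] is orthogonal to [A], hence
    zero. *)
Lemma orth_dense (A : set H) : is_subspace A ->
  (forall z, (forall y, A y -> '[z, y] = 0) -> z = 0) -> dense A.
Proof.
move=> sA A0.
have scl : is_subspace (closure A).
  split; first exact: (@subset_closure _ A _ sA.1).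
  move=> a x y /rn_closureP cx /rn_closureP cy; apply/rn_closureP => e e0.
  have a0 : 0 < rn a + 1 by rewrite ltr_wpDl// rn_ge0.
  have [x' Ax' xx'] := cx (e / 2 / (rn a + 1)) (divr_gt0 (divr_gt0 e0 (ltr0Sn _ 1)) a0).
  have [y' Ay' yy'] := cy (e / 2) (divr_gt0 e0 (ltr0Sn _ 1)).
  exists (a *: x' + y'); first exact: sA.2.
  rewrite opprD addrACA -scalerBr (le_lt_trans (rnD _ _))// rnZ.
  move: xx'; rewrite ltr_pdivlMr// mulrDr mulr1 mulrC.
  by have := rn_ge0 (x' - x); lra.
pose L := ClosedSubspace scl (@closed_closure _ A).
apply: rn_dense => x e; apply: (rn_closureP A x).1.
have [y Ly yP] := projection_ex L x.
suff -> : x = y by [].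
apply/eqP; rewrite -subr_eq0; apply/eqP/A0 => z Az; apply: yP.
exact: subset_closure.
Qed.

End Projection.

(** Pairing a vector identity with an arbitrary vector turns it into a scalar identity within reach
    of [ring]. *)
Ltac vring := apply: ip_inj => ?;
  rewrite ?(ipDl, ipBl, ipNl, ipZl, ip0l); try ring.

(** * Bounded operators *)

Section BoundedLinear.
Context {R : realType}.

(** No operator norm is attached: estimates are carried pointwise, with whatever real bound is at
    hand. *)
Record bop (V W : normedModType R[i]) := Bop {
  bop_linear :> {linear V -> W};
  bop_bounded : exists M : R, forall x, rn (bop_linear x) <= M * rn x
}.

Definition mk_bop (V W : normedModType R[i]) (f : V -> W) (lf : linear f)
    (bf : exists M : R, forall x, rn (f x) <= M * rn x) : bop V W :=
  @Bop V W (HB.pack f (GRing.isLinear.Build _ _ _ _ _ lf)) bf.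

Lemma bop_bound (V W : normedModType R[i]) (T : bop V W) :
  exists2 M : R, 0 < M & forall x, rn (T x) <= M * rn x.
Proof.
have [M MP] := bop_bounded T; exists (`|M| + 1) => [|x].
  by rewrite ltr_wpDl.
rewrite (le_trans (MP x))// ler_wpM2r ?rn_ge0// (le_trans (ler_norm M))//.
by rewrite lerDl.
Qed.

Lemma bop_cvg (V W : normedModType R[i]) (T : bop V W) (u : nat -> V) (l : V) :
  u @ \oo --> l -> (fun n => T (u n)) @ \oo --> T l.
Proof.
move=> /rn_cvg_seqP ul; apply/rn_cvg_seqP => e e0.
have [M M0 MP] := bop_bound T.
have [N NP] := ul (e / M) (divr_gt0 e0 M0); exists N => n /NP.
by rewrite -raddfB /= ltr_pdivlMr// mulrC; apply: le_lt_trans (MP _).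
Qed.

Definition bid {V : normedModType R[i]} : bop V V.
Proof.
exists (GRing.Linear.clone _ V V _ idfun _).
by exists 1 => x; rewrite mul1r.
Defined.

Definition bcomp (U V W : normedModType R[i]) (S : bop V W) (T : bop U V) : bop U W.
Proof.
exists (S \o T); have [M M0 MP] := bop_bound S; have [N N0 NP] := bop_bound T.
exists (M * N) => x /=; rewrite (le_trans (MP _))// -mulrA.
by rewrite ler_pM2l.
Defined.

Definition badd (V W : normedModType R[i]) (S T : bop V W) : bop V W.
Proof.
exists (S \+ T); have [M M0 MP] := bop_bound S; have [N N0 NP] := bop_bound T.
by exists (M + N) => x /=; rewrite (le_trans (rnD _ _))// mulrDl lerD.
Defined.

Definition bscale (V W : normedModType R[i]) (a : R[i]) (T : bop V W) : bop V W.
Proof.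
exists (a \*: T); have [M M0 MP] := bop_bound T.
by exists (rn a * M) => x /=; rewrite rnZ -mulrA ler_wpM2l ?rn_ge0.
Defined.

End BoundedLinear.

(** * Riesz representation and adjoints *)

Section Riesz.
Context {R : realType}.

Lemma le0_eps (r : R) : (forall e, 0 < e -> r <= e) -> r <= 0.
Proof. by move=> re; apply/ler_addgt0Pr => e /re; rewrite add0r. Qed.

(** If [phi] is not zero, its closed kernel has a nonzero orthogonal vector [g]; since x - (phi x /
    phi g) g lies in the kernel, [phi] is the inner product with a multiple of [g]. *)
Lemma riesz (H : hilbertType R) (phi : H -> R[i]) (M : R) :
  (forall a x y, phi (a *: x + y) = a * phi x + phi y) ->
  (forall x, rn (phi x) <= M * rn x) -> exists w, forall x, phi x = '[x, w].
Proof.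
move=> phiP phiM.
have phi0 : phi 0 = 0.
  by have := phiP 1 0 0; rewrite scale1r addr0 mul1r => /eqP;
     rewrite -{1}(addr0 (phi 0)) (inj_eq (addrI _)) => /eqP/esym.
have phiZ a x : phi (a *: x) = a * phi x by rewrite -(addr0 (_ *: _)) phiP phi0 addr0.
have phiD x y : phi (x + y) = phi x + phi y by rewrite -{1}(scale1r x) phiP mul1r.
have phiB x y : phi (x - y) = phi x - phi y by rewrite phiD -scaleN1r phiZ mulN1r.
pose A : set H := [set x | phi x = 0].
have sA : is_subspace A.
  by split=> [|a x y]; rewrite /A /= ?phiP// => -> ->; rewrite mulr0 addr0.
have cA : closed A.
  move=> x /rn_closureP cx; apply: rn_eq0; apply/eqP; rewrite eq_le rn_ge0 andbT.
  apply: le0_eps => e e0; have M0 : 0 < `|M| + 1 by rewrite ltr_wpDl.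
  have [y Ay yx] := cx (e / (`|M| + 1)) (divr_gt0 e0 M0).
  have -> : phi x = phi (x - y) by rewrite phiB (Ay : phi y = 0) subr0.
  rewrite (le_trans (phiM _))// rnBC.
  move: yx; rewrite ltr_pdivlMr// mulrC => /ltW; apply: le_trans.
  by rewrite ler_wpM2r ?rn_ge0// (le_trans (ler_norm M))// lerDl.
pose L := ClosedSubspace sA cA.
have [allA|/existsNP[f fA]] := pselect (forall f, A f).
  by exists 0 => x; rewrite ip0r; exact: allA.
have [y Ly yP] := projection_ex L f.
pose g := f - y.
have pg : phi g = phi f by rewrite phiB Ly subr0.
have pg0 : phi g != 0 by rewrite pg; apply/eqP.
have g0 : g != 0 by apply: contra_neq pg0 => ->.
have gg0 : '[g, g] != 0 by rewrite innerE expf_neq0// normr_eq0.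
exists ((phi g / '[g, g])^* *: g) => x.
have : '[g, x - (phi x / phi g) *: g] = 0.
  by apply: yP; rewrite /= /A /= phiB phiZ divfK// subrr.
move=> /ip_eq0C; rewrite ipBl ipZl => /eqP; rewrite subr_eq0 => /eqP xg.
rewrite ipZr conjCK xg; field; exact/andP.
Qed.

Lemma adjoint_ex (H1 H2 : hilbertType R) (T : bop H1 H2) :
  exists S : bop H2 H1, forall x y, '[T x, y] = '[x, S y].
Proof.
have [M M0 MP] := bop_bound T.
have bT x y : rn '[T x, y] <= M * rn y * rn x.
  rewrite (le_trans (cauchy_schwarz _ _))// mulrAC ler_wpM2r ?rn_ge0//.
have /choice[f fP] : forall y, exists w, forall x, '[T x, y] = '[x, w].
  move=> y; apply: (riesz (M := M * rn y)) => // a u v.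
  by rewrite linearP ipDl ipZl.
have lf : linear f.
  move=> a u v; apply: ip_injr => z.
  by rewrite -fP ipDr ipZr !fP ipDr ipZr.
suff bf : exists M : R, forall y, rn (f y) <= M * rn y.
  by exists (mk_bop lf bf) => x y; exact: fP.
exists M => y; have [->|/rn_gt0 fy0] := eqVneq (f y) 0.
  by rewrite rn0 mulr_ge0 ?rn_ge0// ltW.
rewrite -(ler_pM2r fy0); have := bT (f y) y.
by rewrite fP ipxx rnC ger0_norm ?sqr_ge0.
Qed.

Lemma adjoint_sig (H1 H2 : hilbertType R) (T : bop H1 H2) :
  {S : bop H2 H1 | forall x y, '[T x, y] = '[x, S y]}.
Proof. exact: cid (adjoint_ex T). Qed.

Definition badj (H1 H2 : hilbertType R) (T : bop H1 H2) : bop H2 H1 :=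
  projT1 (adjoint_sig T).

Lemma badjP (H1 H2 : hilbertType R) (T : bop H1 H2) x y :
  '[T x, y] = '[x, badj T y].
Proof. exact: (projT2 (adjoint_sig T)). Qed.

Lemma badjPl (H1 H2 : hilbertType R) (T : bop H1 H2) x y :
  '[badj T y, x] = '[y, T x].
Proof. by rewrite ipC -badjP -ipC. Qed.

(** Cauchy-Schwarz in |T^* y|^2 = <T T^* y, y>. *)
Lemma badj_bound (H1 H2 : hilbertType R) (T : bop H1 H2) (M : R) : 0 <= M ->
  (forall x, rn (T x) <= M * rn x) -> forall y, rn (badj T y) <= M * rn y.
Proof.
move=> M0 MP y; have [->|/rn_gt0 fy0] := eqVneq (badj T y) 0.
  by rewrite rn0 mulr_ge0 ?rn_ge0.
rewrite -(ler_pM2r fy0) mulrAC.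
have := badjP T (badj T y) y; rewrite ipxx => /(congr1 rn).
rewrite rnC ger0_norm ?sqr_ge0// expr2 => <-.
by rewrite (le_trans (cauchy_schwarz _ _))// ler_wpM2r ?rn_ge0.
Qed.

End Riesz.

(** * Uniform boundedness and the closed graph theorem *)

Section UniformBoundedness.
Context {R : realType}.

(* Gliding hump: x = sum of +-3^-n v_n with v_n the unit vector along s_n, the
   signs being chosen so that |<x, s_n>| >= 3^-n |s_n| / 2. *)
Lemma weakly_bounded (H : hilbertType R) (S : set H) :
  (forall x, exists c : R, forall s, S s -> rn '[x, s] <= c) ->
  exists M : R, forall s, S s -> rn s <= M.
Proof.
move=> wS; apply: contrapT => nS.
(* The size of [s n] is chosen so that 3^-n |s n| / 2 exceeds n. *)
have /choice[s sP] : forall n : nat, exists s, S s /\ n%:R * 2 * 3 ^+ n < rn s.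
  move=> n; apply: contrapT => ns; apply: nS; exists (n%:R * 2 * 3 ^+ n) => s Ss.
  by rewrite leNgt; apply/negP => lts; apply: ns; exists s.
have s0 n : 0 < rn (s n).
  by apply: le_lt_trans (sP n).2; rewrite !mulr_ge0// exprn_ge0.
pose t : R := 3^-1.
pose v n := ((t ^+ n / rn (s n))%:C)%C *: s n.
have t0 n : 0 < t ^+ n by rewrite exprn_gt0// invr_gt0.
have vE n : rn (v n) = t ^+ n.
  by rewrite rnZ rnC ger0_norm ?divfK ?gt_eqF// divr_ge0// ltW.
have vs n : '[v n, s n] = (t ^+ n * rn (s n))%:C%C.
  by rewrite ipZl ipxx -CM expr2 mulrA divfK// gt_eqF.
pose fix x n := if n is m.+1 then
  (if t ^+ m * rn (s m) <= rn '[x m + v m, s m] then x m + v m else x m - v m)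
  else 0.
have xS n : rn (x n.+1 - x n) <= 1 * t ^+ n.
  rewrite mul1r -vE /=; case: ifP => _.
    by rewrite addrAC subrr add0r.
  by rewrite addrAC subrr add0r rnN.
have xs n : t ^+ n * rn (s n) <= rn '[x n.+1, s n].
  rewrite /=; case: ifPn => //; rewrite -ltNge ipDl ipBl.
  move: '[x n, s n] => a ab.
  (* The two candidate pairings differ by 2 <v n, s n>, so one of them has modulus at least |<v n, s
     n>|. *)
  have b2 : rn (a + '[v n, s n] - (a - '[v n, s n])) = 2 * (t ^+ n * rn (s n)).
    rewrite (_ : _ - _ = 2 * '[v n, s n]); last by ring.
    rewrite rnM vs -(rmorph_nat (@real_complex R)) !rnC !ger0_norm//.
    by rewrite mulr_ge0 ?rn_ge0// ltW.
  by have := rnB (a + '[v n, s n]) (a - '[v n, s n]); rewrite b2; lra.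
have tb : 0 <= t < 1 by rewrite /t; lra.
have [l _ lP] := geo_cvg tb xS.
have [c cP] := wS l.
have [n] : exists n : nat, c < n%:R.
  by exists (Num.truncn c).+1; rewrite truncnS_gt.
apply/negP; rewrite -leNgt.
apply: le_trans (cP _ (sP n).1).
(* The steps after [x n.+1] add up to at most 3^-(n+1) / (1 - 1/3) = 3^-n / 2, so they undo at most
   half of the gain at step n. *)
have := lP n.+1; rewrite mul1r => lxn.
have {}lxn : rn (x n.+1 - l) <= t ^+ n / 2.
  apply: (le_trans lxn); rewrite exprS le_eqVlt; apply/orP; left; apply/eqP.
  by move: (t ^+ n) => q; rewrite /t; field.
have E : rn '[x n.+1, s n] <= rn '[l, s n] + t ^+ n / 2 * rn (s n).
  apply: (le_trans (rn_dist _ '[l, s n])); rewrite lerD2l -ipBl.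
  by apply: (le_trans (cauchy_schwarz _ _)); rewrite ler_pM2r.
have : n%:R * 2 <= t ^+ n * rn (s n).
  have := (sP n).2; rewrite -ltr_pdivlMr ?exprn_gt0// => /ltW/le_trans; apply.
  by rewrite mulrC /t exprVn.
have := xs n; lra.
Qed.

End UniformBoundedness.

Section ClosedGraph.
Context {R : realType}.

Lemma dense_rn (V : normedModType R[i]) (A : set V) : dense A ->
  forall (x : V) (e : R), 0 < e -> exists2 y, A y & rn (y - x) < e.
Proof.
move=> dA x e e0; have e0' : 0 < (e%:C)%C by rewrite ltcR.
have [y [xy Ay]] := dA (ball x (e%:C)%C) (ex_intro _ x (ballxx x e0')) (ball_open x _).
by exists y => //; move: xy; rewrite -ball_normE /= rnE ltcR rnBC.
Qed.

Lemma closure_seq (V : normedModType R[i]) (A : set V) (x : V) : closure A x ->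
  exists2 u : nat -> V, (forall n, A (u n)) & u @ \oo --> x.
Proof.
move=> /rn_closureP cx.
have /choice[u uP] : forall n : nat, exists y, A y /\ rn (y - x) < n.+1%:R^-1.
  by move=> n; have [|y Ay yx] := cx n.+1%:R^-1; [rewrite invr_gt0|exists y].
exists u => [n|]; first exact: (uP n).1.
apply/rn_cvg_seqP => e e0; have [N] := ltr_add_invr e0; rewrite add0r => NP.
exists N => n Nn; apply: lt_trans (uP n).2 _; apply: le_lt_trans NP.
by rewrite lef_pV2 ?posrE ?ltr0n// ler_nat ltnS.
Qed.

Lemma cvg_seq_le (V W : normedModType R[i]) (f : V -> W) (u : nat -> V) (l : V) :
  (forall x y, rn (f x - f y) <= rn (x - y)) -> u @ \oo --> l ->
  (fun n => f (u n)) @ \oo --> f l.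
Proof.
move=> fle /rn_cvg_seqP ul; apply/rn_cvg_seqP => e /ul[N NP]; exists N => n /NP.
exact: le_lt_trans.
Qed.

Lemma rn_fst_le (H1 H2 : hilbertType R) (x : hsum H1 H2) : rn x.1 <= rn x.
Proof. by rewrite -lecR -!rnE; exact: hsum_fst_le. Qed.

Lemma rn_snd_le (H1 H2 : hilbertType R) (x : hsum H1 H2) : rn x.2 <= rn x.
Proof. by rewrite -lecR -!rnE; exact: hsum_snd_le. Qed.

Lemma rn_hsum_le (H1 H2 : hilbertType R) (x : hsum H1 H2) :
  rn x <= rn x.1 + rn x.2.
Proof. by rewrite -lecR CD -!rnE; exact: hsum_le. Qed.

Lemma ip_hsum (H1 H2 : hilbertType R) (x y : hsum H1 H2) :
  '[x, y] = '[x.1, y.1] + '[x.2, y.2].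
Proof. by []. Qed.

(* The domain of the adjoint of [T] is dense since the graph of [T] is closed,
   and the functionals <T x, y>, for y of norm at most 1 in that domain, are
   represented by a weakly bounded set of vectors. *)
Lemma closed_graph (H1 H2 : hilbertType R) (T : H1 -> H2) : linear T ->
  (forall (u : nat -> H1) x y, u @ \oo --> x -> T \o u @ \oo --> y -> y = T x) ->
  exists M : R, forall x, rn (T x) <= M * rn x.
Proof.
move=> lT cT; pose T' := HB.pack_for {linear H1 -> H2} T (GRing.isLinear.Build _ _ _ _ _ lT).
have T0 : T 0 = 0 by exact: (linear0 T').
have TZ a x : T (a *: x) = a *: T x by exact: (linearZ_LR T').
pose G : set (hsum H1 H2) := [set z | z.2 = T z.1].
have sG : is_subspace G.
  split=> [|a [x1 x2] [y1 y2]]; rewrite /G /=; first by rewrite T0.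
  by move=> -> ->; rewrite lT.
have cG : closed G.
  move=> z /closure_seq[u uG uz]; apply: (cT (fun n => (u n).1)).
    by apply: (@cvg_seq_le (hsum H1 H2) H1 fst) uz => x y; exact: (rn_fst_le (x - y)).
  have -> : T \o (fun n => (u n).1) = fun n => (u n).2.
    by apply/funext => n /=; rewrite (uG n).
  by apply: (@cvg_seq_le (hsum H1 H2) H2 snd) uz => x y; exact: (rn_snd_le (x - y)).
pose L := ClosedSubspace sG cG.
pose D : set H2 := [set y | exists w, forall x, '[T x, y] = '[x, w]].
have sD : is_subspace D.
  split=> [|a y y' [w wP] [w' w'P]].
    by exists 0 => x; rewrite !ip0r.
  by exists (a *: w + w') => x; rewrite !ipDr !ipZr wP w'P.
(* If (x0, T x0) is the projection of (0, z) onto the graph, the residual (- x0, z - T x0) is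
   orthogonal to the graph. So z - T x0 is in [D], represented by x0, and pairing it with itself
   gives |z - T x0|^2 = - |x0|^2. *)
have D0 z : (forall y, D y -> '[z, y] = 0) -> z = 0.
  move=> zD; have [[x0 x2] /= Gx0 pP] := projection_ex L (0, z).
  rewrite /G /= in Gx0; rewrite {x2}Gx0 in pP.
  have yP x : '[T x, z - T x0] = '[x, x0].
    have := pP (x, T x) erefl; rewrite ip_hsum /= sub0r ipNl => /eqP.
    rewrite addrC subr_eq0 => /eqP E.
    by rewrite ipC E -ipC.
  have Dy : D (z - T x0) by exists x0.
  have := ipxx (z - T x0); rewrite ipBl (zD _ Dy) yP sub0r ipxx => /eqP.
  rewrite eq_sym -addr_eq0 -CD => /eqP /complexI /eqP.
  rewrite paddr_eq0 ?sqr_ge0// !sqrf_eq0 => /andP[/eqP/rn_eq0 + /eqP/rn_eq0 x00].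
  by rewrite x00 T0 subr0.
have dD := orth_dense sD D0.
pose S : set H1 := [set w | exists2 y, rn y <= 1 & forall x, '[T x, y] = '[x, w]].
have [M MP] : exists M : R, forall s, S s -> rn s <= M.
  apply: weakly_bounded => x; exists (rn (T x)) => s [y y1 yP].
  by rewrite -yP (le_trans (cauchy_schwarz _ _))// ler_piMr ?rn_ge0.
have M0 : 0 <= M.
  by rewrite -(@rn0 R H1) MP//; exists 0; rewrite ?rn0// => x; rewrite !ip0r.
exists M => x.
have TD y : D y -> rn '[T x, y] <= M * rn x * rn y.
  move=> [w wP]; have [->|/rn_gt0 y0] := eqVneq y 0; first by rewrite ip0r !rn0 mulr0.
  have : rn ((((rn y)^-1)%:C)%C *: w) <= M.
    apply: MP; exists ((((rn y)^-1)%:C)%C *: y).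
      by rewrite rnZ rnC ger0_norm ?invr_ge0 ?(ltW y0)// mulVf ?(gt_eqF y0).
    by move=> z; rewrite !ipZr wP.
  rewrite rnZ rnC ger0_norm ?invr_ge0 ?(ltW y0)// mulrC ler_pdivrMr// => wM.
  rewrite wP (le_trans (cauchy_schwarz _ _))// mulrC -mulrA [leRHS]mulrCA mulrC.
  by rewrite ler_wpM2l ?rn_ge0.
apply/ler_addgt0Pr => e e0.
have [->|/rn_gt0 Tx0] := eqVneq (T x) 0.
  by rewrite rn0 addr_ge0 ?mulr_ge0 ?rn_ge0// ltW.
have K0 : 0 < rn (T x) + M * rn x by rewrite ltr_wpDr// mulr_ge0 ?rn_ge0.
(* Testing against a vector [y] of [D] within [d] of T x costs at most d times |T x| + M |x|; this
   [d] makes the cost e |T x|. *)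
pose d := e * rn (T x) / (rn (T x) + M * rn x).
have d0 : 0 < d by rewrite divr_gt0// mulr_gt0.
have [y Dy yT] := dense_rn dD (T x) d0.
rewrite -(ler_pM2r Tx0).
have : rn (T x) * rn (T x) <= rn (T x) * rn (y - T x) + M * rn x * rn y.
  have := ipxx (T x); rewrite -{2}(subrK y (T x)) ipDr => /(congr1 rn).
  rewrite rnC ger0_norm ?sqr_ge0// expr2 => <-.
  rewrite (le_trans (rnD _ _))// lerD ?TD//.
  by rewrite (le_trans (cauchy_schwarz _ _))// (rnBC y).
have : rn y <= rn (T x) + rn (y - T x) by exact: rn_dist.
move: yT; rewrite /d ltr_pdivlMr// => yT yT2 TT.
have : M * rn x * rn y <= M * rn x * (rn (T x) + rn (y - T x)).
  by rewrite ler_wpM2l// mulr_ge0// rn_ge0.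
by move: TT yT; move: (rn (T x)) (rn (y - _)) (rn y) (rn x) => a b c d'; nra.
Qed.

End ClosedGraph.

(** * Neumann series and square roots of positive operators *)

Section SquareRoot.
Context {R : realType}.

(** Identities between limits are proved with this: the defect is estimated along the iteration at
    every step [n]. *)
Lemma geo_eq0 (V : normedZmodType R[i]) (x : V) (c t : R) :
  0 <= t < 1 -> (forall n, rn x <= c * t ^+ n) -> x = 0.
Proof.
move=> tb xc; have c0 : 0 <= c.
  by have := xc 0%N; rewrite expr0 mulr1; apply/le_trans/rn_ge0.
apply/rn_eq0/eqP; rewrite eq_le rn_ge0 andbT; apply: le0_eps => e e0.
have [N /(_ N (leqnn N)) /ltW] := geo_lt tb c0 e0; exact: le_trans.
Qed.

(** The solution of x - B x = y is the limit of the iteration x -> y + B x started at 0; uniqueness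
    of the solution makes the solution map linear and a two-sided inverse. *)
Lemma neumann (H : hilbertType R) (B : bop H H) (t : R) : 0 <= t < 1 ->
  (forall x, rn (B x) <= t * rn x) ->
  exists S : bop H H, forall x, S (x - B x) = x /\ S x - B (S x) = x.
Proof.
move=> tb Bt; have /andP[t0 t1] := tb.
have t1' : 0 < 1 - t by rewrite subr_gt0.
have uniq x y : x - B x = y - B y -> x = y.
  move=> xy; apply/eqP; rewrite -subr_eq0; apply/eqP.
  have E : x - y = B (x - y).
    by rewrite (linearB B) -{1}(subrK (B x) x) xy; vring.
  apply: (@geo_eq0 _ _ (rn (x - y)) t) => //.
  elim=> [|n IH]; first by rewrite expr0 mulr1.
  rewrite {1}E (le_trans (Bt _))// exprS mulrCA.
  by rewrite ler_wpM2l.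
have /choice[S SP] : forall y, exists x, x - B x = y.
  move=> y; pose u n := iter n (fun x => y + B x) 0.
  have uS n : rn (u n.+1 - u n) <= rn y * t ^+ n.
    elim: n => [|n IH]; first by rewrite /= linear0 addr0 subr0 expr0 mulr1.
    rewrite /= opprD addrACA subrr add0r -linearB exprS mulrCA.
    by rewrite (le_trans (Bt _))// ler_wpM2l.
  have [l _ lP] := geo_cvg tb uS; exists l; apply/eqP; rewrite -subr_eq0; apply/eqP.
  apply: (@geo_eq0 _ _ (2 * (rn y / (1 - t))) t) => // n.
  have -> : l - B l - y = - (u n.+1 - l) + B (u n - l).
    by rewrite (linearB B) (_ : u n.+1 = y + B (u n)) //; vring.
  rewrite (le_trans (rnD _ _))// rnN.
  have := lP n.+1; have := lP n; have := Bt (u n - l).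
  have : t * rn (u n - l) <= rn (u n - l) by rewrite ler_piMl ?rn_ge0// ltW.
  have : rn y * t ^+ n.+1 / (1 - t) <= rn y * t ^+ n / (1 - t).
    rewrite ler_pM2r ?invr_gt0// exprS mulrCA ler_piMl ?(ltW t1)//.
    by rewrite mulr_ge0 ?rn_ge0 ?exprn_ge0.
  have -> : 2 * (rn y / (1 - t)) * t ^+ n = 2 * (rn y * t ^+ n / (1 - t)) by ring.
  lra.
have lS : linear S.
  move=> a x y; apply: uniq; rewrite SP linearP -[in LHS](SP x) -[in LHS](SP y).
  by vring.
suff bS : exists M : R, forall x, rn (S x) <= M * rn x.
  by exists (mk_bop lS bS) => x; split=> /=; [apply: uniq; rewrite SP|exact: SP].
exists (1 - t)^-1 => x; rewrite mulrC ler_pdivlMr//.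
by have := rn_dist (S x) (B (S x)); rewrite SP; have := Bt (S x); lra.
Qed.

Definition selfadj (H : hilbertType R) (T : H -> H) := forall x y, '[T x, y] = '[x, T y].

(* [1 - Y] is the square root of [1 - B]. *)
Lemma sqrt_one_sub (H : hilbertType R) (B : bop H H) (t : R) : 0 <= t < 1 ->
  (forall x, rn (B x) <= t * rn x) -> selfadj B ->
  exists Y : bop H H, [/\ forall x, rn (Y x) <= t * rn x, selfadj Y &
    forall x, B x + Y (Y x) = 2 *: Y x].
Proof.
move=> tb Bt sB; have /andP[t0 t1] := tb.
have t1' : 0 < 1 - t by rewrite subr_gt0.
(* The fixed points of Z -> (B + Z^2) / 2 are the operators with (1 - Z)^2 = 1 - B; the iteration
   starts at 0 and keeps the bound [t]. *)
pose Yn n : bop H H :=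
  iter n (fun Z => bscale 2^-1 (badd B (bcomp Z Z))) (bscale 0 bid).
have r2 : rn (2^-1 : R[i]) = 2^-1.
  by rewrite rnV -(rmorph_nat (@real_complex R)) rnC ger0_norm.
have YS n x : Yn n.+1 x = 2^-1 *: (B x + Yn n (Yn n x)) by [].
have Y0 x : Yn 0%N x = 0 by rewrite /= scale0r.
have Yt n x : rn (Yn n x) <= t * rn x.
  elim: n x => [|n IH] x; first by rewrite Y0 rn0 mulr_ge0 ?rn_ge0.
  rewrite YS rnZ r2; have := rnD (B x) (Yn n (Yn n x)); have := Bt x.
  have : rn (Yn n (Yn n x)) <= t * rn x.
    rewrite (le_trans (IH _))// ler_wpM2l// (le_trans (IH _))//.
    by rewrite ler_piMl ?rn_ge0// ltW.
  lra.
have Ysa n : selfadj (Yn n).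
  elim: n => [|n IH] x y; first by rewrite !Y0 ip0l ip0r.
  rewrite !YS ipZl ipZr ipDl ipDr sB !IH; congr (_ * _).
  by rewrite -(rmorph_nat (@real_complex R)) -fmorphV conjC_real.
have Yd n x : rn (Yn n.+1 x - Yn n x) <= rn x * t ^+ n.
  elim: n x => [|n IH] x.
    rewrite YS !Y0 subr0 addr0 rnZ r2 expr0 mulr1.
    have : t * rn x <= rn x by rewrite ler_piMl ?rn_ge0// ltW.
    by have := Bt x; have := rn_ge0 x; lra.
  rewrite (YS n.+1) (YS n x) -scalerBr rnZ r2.
  (* Consecutive iterates Z, Z' satisfy Z'^2 - Z^2 = Z' (Z' - Z) + (Z' - Z) Z without commuting, and
     each term gains a factor [t]. *)
  have -> : B x + Yn n.+1 (Yn n.+1 x) - (B x + Yn n (Yn n x)) =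
      Yn n.+1 (Yn n.+1 x - Yn n x) + (Yn n.+1 (Yn n x) - Yn n (Yn n x)).
    by rewrite (linearB (Yn n.+1)); vring.
  have := rnD (Yn n.+1 (Yn n.+1 x - Yn n x)) (Yn n.+1 (Yn n x) - Yn n (Yn n x)).
  have := Yt n.+1 (Yn n.+1 x - Yn n x); have := IH (Yn n x).
  have : t * rn (Yn n.+1 x - Yn n x) <= t * (rn x * t ^+ n) by rewrite ler_wpM2l.
  have : rn (Yn n x) * t ^+ n <= t * rn x * t ^+ n.
    by rewrite ler_wpM2r ?exprn_ge0.
  rewrite exprS; move: (t ^+ n) => q.
  lra.
have /choice[Y YP] : forall x, exists l, forall n,
    rn (Yn n x - l) <= rn x * t ^+ n / (1 - t).
  by move=> x; have [l _ lP] := geo_cvg tb (fun n => Yd n x); exists l.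
pose c := (1 - t)^-1.
have c0 : 0 < c by rewrite invr_gt0.
have {}YP x n : rn (Yn n x - Y x) <= c * rn x * t ^+ n.
  by rewrite (le_trans (YP x n))// mulrC mulrA.
have lY : linear Y.
  move=> a x y; apply/eqP; rewrite -subr_eq0; apply/eqP.
  apply: (@geo_eq0 _ _ (c * rn (a *: x + y) + rn a * (c * rn x) + c * rn y) t) => // n.
  have -> : Y (a *: x + y) - (a *: Y x + Y y) = - (Yn n (a *: x + y) - Y (a *: x + y))
      + a *: (Yn n x - Y x) + (Yn n y - Y y).
    by rewrite (linearP (Yn n)); vring.
  rewrite (le_trans (rnD _ _))// 2!mulrDl lerD// (le_trans (rnD _ _))// rnN rnZ.
  by rewrite lerD// -mulrA ler_wpM2l ?rn_ge0.
have Yt' x : rn (Y x) <= t * rn x.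
  apply/ler_addgt0Pr => e e0.
  have [N /(_ N (leqnn N)) NP] := geo_lt tb (mulr_ge0 (ltW c0) (rn_ge0 x)) e0.
  have := rn_dist (Y x) (Yn N x); rewrite rnBC.
  by have := YP x N; have := Yt N x; lra.
have bY : exists M : R, forall x, rn (Y x) <= M * rn x by exists t.
exists (mk_bop lY bY); split => //=.
- move=> x y /=; apply/eqP; rewrite -subr_eq0; apply/eqP.
  apply: (@geo_eq0 _ _ (2 * c * rn x * rn y) t) => // n.
  have -> : '[Y x, y] - '[x, Y y] = '[x, Yn n y - Y y] - '[Yn n x - Y x, y].
    by rewrite ipBr ipBl Ysa; ring.
  rewrite (le_trans (rnB _ _))//.
  have := cauchy_schwarz x (Yn n y - Y y); have := cauchy_schwarz (Yn n x - Y x) y.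
  have : rn x * rn (Yn n y - Y y) <= rn x * (c * rn y * t ^+ n).
    by rewrite ler_wpM2l ?rn_ge0.
  have : rn (Yn n x - Y x) * rn y <= (c * rn x * t ^+ n) * rn y.
    by rewrite ler_wpM2r ?rn_ge0.
  by lra.
- move=> x /=; apply/eqP; rewrite -subr_eq0; apply/eqP.
  apply: (@geo_eq0 _ _ (c * rn (Y x) + t * (c * rn x) + 2 * (c * rn x)) t) => // n.
  have -> : B x + Y (Y x) - 2 *: Y x =
      - (Yn n (Y x) - Y (Y x)) - Yn n (Yn n x - Y x) + 2 *: (Yn n.+1 x - Y x).
    by rewrite (linearB (Yn n)) YS; vring; field.
  rewrite (le_trans (rnD _ _))// 2!mulrDl lerD//.
    rewrite (le_trans (rnB _ _))// rnN lerD//.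
    by rewrite (le_trans (Yt _ _))// -mulrA ler_wpM2l.
  rewrite rnZ -(rmorph_nat (@real_complex R)) rnC ger0_norm// -mulrA ler_wpM2l//.
  rewrite (le_trans (YP _ _))// exprS mulrCA ler_piMl ?(ltW t1)//.
  by rewrite mulr_ge0 ?exprn_ge0// mulr_ge0 ?rn_ge0// ltW.
Qed.

(** [S] and [Q] are T^(-1/2) and T^(1/2). With c = k / M^2 and q = k^2 / M^2, expanding |x - c T
    x|^2 bounds it by (1 - q) |x|^2, so 1 - c T is a contraction with constant 1 - q / 2. Hence c T
    has a square root 1 - Y with Y a contraction, invertible by a Neumann series. *)
Lemma inverse_sqrt (H : hilbertType R) (T : bop H H) (k : R) : 0 < k ->
  (forall x, k * rn x ^+ 2 <= complex.Re '[T x, x]) -> selfadj T ->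
  exists S Q : bop H H, [/\ selfadj S, selfadj Q,
    forall x, S (T (S x)) = x, forall x, S (Q x) = x & forall x, Q (S x) = x].
Proof.
move=> k0 kT sT.
(* Taking the bound with k <= M gives q <= 1, which keeps [t] nonnegative. *)
have [M [kM MP]] : exists M, k <= M /\ forall x, rn (T x) <= M * rn x.
  have [M M0 MP] := bop_bound T; exists (M + k); split=> [|x]; first by rewrite lerDr ltW.
  by rewrite (le_trans (MP x))// mulrDl lerDl mulr_ge0 ?rn_ge0 ?(ltW k0).
have M0 : 0 < M by exact: lt_le_trans kM.
pose c := k / M ^+ 2; pose q := k ^+ 2 / M ^+ 2.
have c0 : 0 < c by rewrite divr_gt0// exprn_gt0.
have q0 : 0 < q by rewrite divr_gt0// exprn_gt0.
have q1 : q <= 1 by rewrite ler_pdivrMr ?exprn_gt0// mul1r ler_pXn2r// nnegrE ?(ltW k0) ?(ltW M0).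
pose t := 1 - q / 2.
have tb : 0 <= t < 1 by rewrite /t; lra.
pose B := badd bid (bscale (- c%:C)%C T).
have BE x : B x = x - (c%:C)%C *: T x by rewrite /= scaleNr.
have Bt x : rn (B x) <= t * rn x.
  rewrite -(@ler_pXn2r _ 2)// ?nnegrE ?rn_ge0//; last first.
    by rewrite mulr_ge0 ?rn_ge0//; case/andP: tb.
  rewrite BE rn_sqrB rnZ rnC ger0_norm ?(ltW c0)// ipZr conjC_real ReCM -sT.
  have Tx : rn (T x) ^+ 2 <= M ^+ 2 * rn x ^+ 2.
    by rewrite -exprMn ler_pXn2r// nnegrE ?rn_ge0// mulr_ge0 ?rn_ge0// ltW.
  have : c ^+ 2 * rn (T x) ^+ 2 <= c ^+ 2 * (M ^+ 2 * rn x ^+ 2).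
    by rewrite ler_wpM2l ?sqr_ge0.
  have -> : c ^+ 2 * (M ^+ 2 * rn x ^+ 2) = q * rn x ^+ 2.
    by rewrite /c /q; field; rewrite gt_eqF.
  have : c * (k * rn x ^+ 2) <= c * complex.Re '[T x, x] by rewrite ler_wpM2l ?(ltW c0) ?kT.
  have -> : c * (k * rn x ^+ 2) = q * rn x ^+ 2.
    by rewrite /c /q; field; rewrite gt_eqF.
  have : 0 <= (q / 2) ^+ 2 * rn x ^+ 2 by rewrite mulr_ge0 ?sqr_ge0.
  have -> : (t * rn x) ^+ 2 = (1 - q / 2) ^+ 2 * rn x ^+ 2 by rewrite exprMn.
  have -> : (c * rn (T x)) ^+ 2 = c ^+ 2 * rn (T x) ^+ 2 by rewrite exprMn.
  by clearbody c q; lra.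
have sB : selfadj B by move=> x y; rewrite !BE ipBl ipBr ipZl ipZr conjC_real sT.
have [Y [Yt sY YE]] := sqrt_one_sub tb Bt sB.
have [S1 S1P] := neumann tb Yt.
pose Q1 := badd bid (bscale (-1) Y).
have Q1E x : Q1 x = x - Y x by rewrite /= scaleN1r.
have QQ x : Q1 (Q1 x) = (c%:C)%C *: T x.
  rewrite !Q1E (linearB Y).
  have -> : Y (Y x) = 2 *: Y x - B x by rewrite -YE; vring.
  by rewrite BE; vring.
have SQ x : S1 (Q1 x) = x by rewrite Q1E (S1P x).1.
have QS x : Q1 (S1 x) = x by rewrite Q1E (S1P x).2.
have sQ : selfadj Q1 by move=> x y; rewrite !Q1E ipBl ipBr sY.
have sS : selfadj S1 by move=> x y; rewrite -{1}(QS y) -sQ QS.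
pose r := Num.sqrt c.
have r0 : r != 0 by rewrite gt_eqF// sqrtr_gt0.
have rC0 : ((r%:C)%C : R[i]) != 0 by rewrite (inj_eq (@complexI R)).
have scaleE a (Z : bop H H) x : bscale a Z x = a *: Z x by [].
exists (bscale (r%:C)%C S1), (bscale (r^-1%:C)%C Q1).
split=> [x y|x y|x|x|x]; rewrite !scaleE.
- by rewrite ipZl ipZr conjC_real sS.
- by rewrite ipZl ipZr conjC_real sQ.
- rewrite !linearZ /= scalerA -CM -expr2 sqr_sqrtr ?(ltW c0)//.
  by rewrite -(linearZ_LR S1) -QQ SQ QS.
- by rewrite (linearZ_LR S1) SQ scalerA -CM divff// scale1r.
- by rewrite (linearZ_LR Q1) QS scalerA -CM mulVf// scale1r.
Qed.

End SquareRoot.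

(** * Symmetric operators at Y-regular points *)

Section ClosedSubspaceProjection.
Context {R : realType}.
Variables (X : hilbertType R) (Y : closed_subspace X).

Lemma sub_ipE (y z : sub_hilbert Y) : '[y, z] = '[\val y, \val z].
Proof. by []. Qed.

Lemma in_cs (x : X) : cs_set Y x -> exists y : sub_hilbert Y, \val y = x.
Proof.
move=> Yx; have Px : cs_pred Y x by rewrite /cs_pred in_setE.
by exists (Sub x Px).
Qed.

Lemma ortho_proj_val (y : sub_hilbert Y) : ortho_proj Y (\val y) = y.
Proof. by apply: ortho_proj_unique => l _; rewrite subrr ip0l. Qed.

Lemma ortho_proj_ip (f : X) (y : sub_hilbert Y) :
  '[ortho_proj Y f, y] = '[f, \val y].
Proof.
have := ortho_projP f (cs_valP y); rewrite ipBl => /eqP.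
by rewrite subr_eq0 => /eqP ->.
Qed.

Lemma ortho_proj_linear : linear (ortho_proj Y).
Proof.
by move=> a f g; apply: ip_inj => y; rewrite !(ipDl, ipZl) !ortho_proj_ip ipDl ipZl.
Qed.

Lemma ortho_proj_bounded : exists M : R, forall f, rn (ortho_proj Y f) <= M * rn f.
Proof.
exists 1 => f; rewrite mul1r; set p := ortho_proj Y f.
have [->|/rn_gt0 p0] := eqVneq p 0; first by rewrite rn0 rn_ge0.
rewrite -(ler_pM2r p0); have := cauchy_schwarz f (\val p).
by rewrite -ortho_proj_ip ipxx rnC ger0_norm ?sqr_ge0.
Qed.

Definition bproj : bop X (sub_hilbert Y) := mk_bop ortho_proj_linear ortho_proj_bounded.

Lemma ortho_projZ (a : R[i]) f : ortho_proj Y (a *: f) = a *: ortho_proj Y f.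
Proof. exact: (linearZ_LR bproj). Qed.

End ClosedSubspaceProjection.

Section Operator.
Context {R : realType}.
Variables (X : hilbertType R) (E : operator X).
Hypotheses (E_linear : linear_op E) (E_closed : closed_op E).
Hypotheses (E_symmetric : symmetric_op E) (E_simple : simple_op E).

Lemma dom0 : dom E 0. Proof. by case: E_linear => -[]. Qed.

Lemma domP (a : R[i]) f g : dom E f -> dom E g -> dom E (a *: f + g).
Proof. by case: E_linear => -[_ +] _; apply. Qed.

Lemma domB f g : dom E f -> dom E g -> dom E (f - g).
Proof. by move=> Ef Eg; rewrite addrC -scaleN1r; apply: domP. Qed.

Lemma opP (a : R[i]) f g : dom E f -> dom E g -> E (a *: f + g) = a *: E f + E g.
Proof. by case: E_linear => _; apply. Qed.

Lemma op0 : E 0 = 0.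
Proof.
have := opP 1 dom0 dom0; rewrite !scale1r addr0 => /eqP.
by rewrite -{1}(addr0 (E 0)) (inj_eq (addrI _)) => /eqP.
Qed.

Lemma opB f g : dom E f -> dom E g -> E (f - g) = E f - E g.
Proof. by move=> Ef Eg; rewrite addrC -scaleN1r opP// scaleN1r addrC. Qed.

Lemma op_closed_seq (u : nat -> X) f h : (forall n, dom E (u n)) ->
  u @ \oo --> f -> (fun n => E (u n)) @ \oo --> h -> dom E f /\ E f = h.
Proof.
move=> Eu uf Euh.
have [g Eg [<- <-]] : [set (f, E f) | f in dom E] (f, h); last by [].
apply: (@closed_cvg nat (X * X)%type \oo _ (fun n => (u n, E (u n))) _ E_closed).
  by apply: nearW => n; exists (u n).
exact: cvg_pair uf Euh.
Qed.

Lemma symm_shift (z : R[i]) f g : dom E f -> dom E g ->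
  '[E f - z *: f, g] = '[f, E g - z^* *: g].
Proof. by move=> Ef Eg; rewrite ipBl ipBr ipZl ipZr conjCK E_symmetric. Qed.

(** An eigenvalue is real by symmetry, and its eigenspace is a closed reducing subspace on which [E]
    is a real multiple of the identity, hence self-adjoint; simplicity excludes this. *)
Lemma eigenvector_eq0 (z : R[i]) f : dom E f -> E f = z *: f -> f = 0.
Proof.
move=> Ef Efz; apply: contrapT => /eqP f0; apply: E_simple.
have zz : z^* = z.
  have := E_symmetric Ef Ef; rewrite Efz ipZl ipZr => /mulIf <-//.
  by rewrite innerE expf_neq0// normr_eq0.
pose A : set X := [set g | dom E g /\ E g = z *: g].
have sA : is_subspace A.
  split; first by split; [exact: dom0|rewrite op0 scaler0].
  move=> a x y [Ex xz] [Ey yz]; split; first exact: domP.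
  by rewrite opP// xz yz scalerDr !scalerA mulrC.
have cA : closed A.
  move=> g /closure_seq[u uA ug].
  apply: (@op_closed_seq u) => // [n|]; first by case: (uA n).
  have -> : (fun n => E (u n)) = (fun n => bscale z bid (u n)).
    by apply/funext => n; case: (uA n).
  exact: (bop_cvg (T := bscale z bid) ug).
pose L := ClosedSubspace sA cA.
have LE (g : sub_hilbert L) : dom E (\val g) /\ E (\val g) = z *: \val g.
  exact: (cs_valP g).
exists L; split; last 1 first.
- split.
    move=> O [x Ox] _; exists x; split=> //; exact: (LE x).1.
  have partE (g : sub_hilbert L) : part E L g = z *: g.
    by rewrite /part /= (LE g).2 ortho_projZ ortho_proj_val.
  move=> f1 h; split=> [adj|[_ <-]].
    split; first exact: (LE f1).1.
    rewrite partE; apply: ip_injr => g; rewrite ipZr zz -ipZl -partE.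
    exact/adj/(LE g).1.
  by move=> g _; rewrite !partE ipZl ipZr zz.
- move=> g Eg; have [Eg1 Eg2] := LE (ortho_proj L g); split=> //.
  rewrite Eg2; apply/esym; rewrite -[RHS](linearZ_LR (\val : sub_hilbert L -> X)).
  congr (\val _); apply: ip_inj => l; rewrite ortho_proj_ip ipZl ortho_proj_ip.
  by have [El lz] := LE l; rewrite E_symmetric// lz ipZr zz.
- by exists f => //; apply/eqP.
Qed.

Variables (Y : closed_subspace X) (z : R[i]).
Hypothesis zreg : regular_point E Y z.

Lemma op_shift_inj f g : dom E f -> dom E g -> E f - z *: f = E g - z *: g -> f = g.
Proof.
move=> Ef Eg fg; apply/eqP; rewrite -subr_eq0; apply/eqP.
apply: (@eigenvector_eq0 z); first exact: domB.
rewrite opB// scalerBr; apply/eqP; rewrite -subr_eq0; apply/eqP.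
have -> : E f - E g - (z *: f - z *: g) = (E f - z *: f) - (E g - z *: g) by vring.
by rewrite fg subrr.
Qed.

Lemma decomposition_unique g (y : sub_hilbert Y) : dom E g ->
  PY E Y z (E g - z *: g + \val y) = y /\ tauY E Y z (E g - z *: g + \val y) = g.
Proof.
move=> Eg; set f := _ + _.
have Py : op_range E z (f - \val y) by exists g => //; rewrite /f addrK.
have PE : PY E Y z f = y.
  apply: xget_unique => // y' [g' Eg' g'f].
  have [_ trivI _] := zreg; apply: val_inj; apply/eqP; rewrite -subr_eq0; apply/eqP.
  apply: trivI; last by apply: subspaceB; [exact: cs_subspace|exact: cs_valP..].
  exists (g - g'); first exact: domB.
  rewrite opB//.
  have -> : E g - E g' - z *: (g - g') = (E g - z *: g) - (E g' - z *: g') by vring.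
  by rewrite g'f /f; vring.
split=> //; rewrite /tauY PE; apply: xget_unique; first by split=> //; rewrite /f addrK.
by move=> g' [Eg' g'f]; apply: op_shift_inj => //; rewrite g'f /f addrK.
Qed.

Lemma decompositionP f : dom E (tauY E Y z f) /\
  E (tauY E Y z f) - z *: tauY E Y z f + \val (PY E Y z f) = f.
Proof.
have [_ _ /(_ f)[_ [_ [[g Eg <-] /in_cs[y <-] ->]]]] := zreg.
by have [-> ->] := decomposition_unique y Eg.
Qed.

Lemma decomposition_eq f g (y : sub_hilbert Y) : dom E g ->
  f = E g - z *: g + \val y -> PY E Y z f = y /\ tauY E Y z f = g.
Proof. by move=> Eg ->; exact: decomposition_unique. Qed.

Lemma decomposition_linear (a : R[i]) f g :
  PY E Y z (a *: f + g) = a *: PY E Y z f + PY E Y z g /\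
  tauY E Y z (a *: f + g) = a *: tauY E Y z f + tauY E Y z g.
Proof.
have [Ef fE] := decompositionP f; have [Eg gE] := decompositionP g.
apply: decomposition_eq; first exact: domP.
rewrite -{1}fE -{1}gE opP// linearP /=.
by vring.
Qed.

(** By the closed graph theorem: if u_n -> f and P u_n -> y, then f - y lies in the range of E - z
    I, which is closed at a regular point. *)
Lemma PY_bounded : exists M : R, forall f, rn (PY E Y z f) <= M * rn f.
Proof.
apply: closed_graph; first by move=> a f g; rewrite (decomposition_linear a f g).1.
move=> u f y uf uy; have [cM _ _] := zreg.
have uy' : (fun n => \val (PY E Y z (u n))) @ \oo --> \val y.
  by apply: (@cvg_seq_le _ (sub_hilbert Y) X \val _ y _ uy) => v w; rewrite -raddfB.
have [g Eg gf] : op_range E z (f - \val y).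
  apply: (@closed_seq _ X _ (fun n => u n - \val (PY E Y z (u n)))) => //.
    move=> n; have [En nE] := decompositionP (u n).
    by exists (tauY E Y z (u n)) => //; apply/eqP; rewrite eq_sym subr_eq nE.
  exact: cvgB.
by have [] // := @decomposition_eq f g y Eg; rewrite gf subrK.
Qed.

(** The closed graph theorem again, now resting on the closedness of [E] and the continuity of the
    projection. *)
Lemma tauY_bounded : exists M : R, forall f, rn (tauY E Y z f) <= M * rn f.
Proof.
have lP : linear (PY E Y z) by move=> a f g; rewrite (decomposition_linear a f g).1.
apply: closed_graph; first by move=> a f g; rewrite (decomposition_linear a f g).2.
move=> u f g uf ug.
have uP := bop_cvg (T := mk_bop lP PY_bounded) uf.
have uP' : (fun n => \val (PY E Y z (u n))) @ \oo --> \val (PY E Y z f).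
  by apply: (@cvg_seq_le _ (sub_hilbert Y) X \val _ _ _ uP) => v w; rewrite -raddfB.
have [Eg gE] : dom E g /\ E g = f - \val (PY E Y z f) + z *: g.
  apply: (@op_closed_seq (fun n => tauY E Y z (u n))) => //.
    by move=> n; have [] := decompositionP (u n).
  have -> : (fun n => E (tauY E Y z (u n))) =
      (fun n => u n - \val (PY E Y z (u n)) + bscale z bid (tauY E Y z (u n))).
    apply/funext => n; have [En nE] := decompositionP (u n).
    by apply/eqP; rewrite -subr_eq eq_sym subr_eq nE.
  apply: cvgD; first exact: cvgB.
  exact: (bop_cvg (T := bscale z bid) ug).
have [] // := @decomposition_eq f g (PY E Y z f) Eg.
by rewrite gE addrK subrK.
Qed.

End Operator.

Section Pairing.
Context {R : realType}.
Variables (V : normedModType R[i]) (H1 H2 : hilbertType R).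

Definition bpair (S : bop V H1) (T : bop V H2) : bop V (hsum H1 H2).
Proof.
apply: (@mk_bop _ V (hsum H1 H2) (fun x => (S x, T x))).
  by move=> a x y; rewrite !linearP.
have [M M0 MP] := bop_bound S; have [N N0 NP] := bop_bound T.
exists (M + N) => x; rewrite (le_trans (rn_hsum_le _))// mulrDl.
by apply: lerD; [exact: MP|exact: NP].
Defined.

Lemma bpairE S T x : bpair S T x = (S x, T x) :> hsum H1 H2.
Proof. by []. Qed.

End Pairing.

(** * Resolvent identities, the Green formula and unobservable vectors *)

Section Model.
Context {R : realType}.
Variables (X : hilbertType R) (E : operator X) (Y : closed_subspace X).
Variable (Om : set R[i]^o).
Hypotheses (E_linear : linear_op E) (E_closed : closed_op E).
Hypotheses (E_symmetric : symmetric_op E) (E_simple : simple_op E).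
Hypothesis Om_open : open Om.
Hypothesis Om_conj : forall z : R[i], Om z -> Om z^*.
Hypothesis Om_regular : forall z, Om z -> regular_point E Y z.

(** Bundling the projections and preimages as bounded operators at every point, with the zero
    operator off [Om], lets them be composed and adjoined without membership proofs in the terms. *)
Lemma model_ex : exists (P : R[i] -> bop X (sub_hilbert Y)) (tau : R[i] -> bop X X),
  forall z, Om z -> forall f, P z f = PY E Y z f /\ tau z f = tauY E Y z f.
Proof.
have /choice[P PP] : forall z : R[i], exists P : bop X (sub_hilbert Y),
    Om z -> forall f, P f = PY E Y z f.
  move=> z; have [Oz|nOz] := pselect (Om z); last by exists (bscale 0 (bproj Y)).
  have zr := Om_regular Oz.
  have lP : linear (PY E Y z).
    by move=> a f g; have [] := decomposition_linear E_linear E_closed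
      E_symmetric E_simple zr a f g.
  by exists (mk_bop lP (PY_bounded E_linear E_closed E_symmetric E_simple zr)).
have /choice[tau tauP] : forall z : R[i], exists tau : bop X X,
    Om z -> forall f, tau f = tauY E Y z f.
  move=> z; have [Oz|nOz] := pselect (Om z); last by exists (bscale 0 bid).
  have zr := Om_regular Oz.
  have lP : linear (tauY E Y z).
    by move=> a f g; have [] := decomposition_linear E_linear E_closed
      E_symmetric E_simple zr a f g.
  by exists (mk_bop lP (tauY_bounded E_linear E_closed E_symmetric E_simple zr)).
by exists P, tau => z Oz f; rewrite PP ?tauP.
Qed.

Variables (P : R[i] -> bop X (sub_hilbert Y)) (tau : R[i] -> bop X X).
Hypothesis PtauE : forall z, Om z -> forall f,
  P z f = PY E Y z f /\ tau z f = tauY E Y z f.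

Lemma tau_dom z f : Om z -> dom E (tau z f).
Proof.
move=> Oz; rewrite (PtauE Oz f).2.
by have [] := decompositionP E_linear E_closed E_symmetric E_simple (Om_regular Oz) f.
Qed.

Lemma PtauP z f : Om z -> E (tau z f) - z *: tau z f + \val (P z f) = f.
Proof.
move=> Oz; have [-> ->] := PtauE Oz f.
by have [] := decompositionP E_linear E_closed E_symmetric E_simple (Om_regular Oz) f.
Qed.

Lemma Ptau_unique z f g y : Om z -> dom E g -> f = E g - z *: g + \val y ->
  P z f = y /\ tau z f = g.
Proof.
move=> Oz Eg fE; have [-> ->] := PtauE Oz f.
exact: (decomposition_eq E_linear E_closed E_symmetric E_simple (Om_regular Oz)).
Qed.

(** Subtracting (l - m) tau_m f from f = (E - m I) tau_m f + P_m f leaves (E - l I) tau_m f + P_m f,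
    which is a decomposition at [l]; both resolvent identities follow by linearity. *)
Lemma resolvent_aux l m f : Om l -> Om m ->
  P l (f - (l - m) *: tau m f) = P m f /\ tau l (f - (l - m) *: tau m f) = tau m f.
Proof.
move=> Ol Om'; apply: Ptau_unique => //; first exact: tau_dom.
by rewrite -{1}(PtauP f Om'); vring.
Qed.

Lemma tau_resolvent l m f : Om l -> Om m ->
  tau l f = tau m f + (l - m) *: tau l (tau m f).
Proof.
move=> Ol Om'; have [_ ] := resolvent_aux f Ol Om'.
by rewrite linearB linearZ /= => /eqP; rewrite subr_eq => /eqP.
Qed.

Lemma P_resolvent l m f : Om l -> Om m ->
  P l f = P m f + (l - m) *: P l (tau m f).
Proof.
move=> Ol Om'; have [+ _] := resolvent_aux f Ol Om'.
by rewrite linearB linearZ /= => /eqP; rewrite subr_eq => /eqP.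
Qed.

Lemma Ptau_val z (y : sub_hilbert Y) : Om z -> P z (\val y) = y /\ tau z (\val y) = 0.
Proof.
move=> Oz; apply: Ptau_unique => //; first exact: dom0.
by rewrite op0// scaler0 subr0 add0r.
Qed.

Definition cpi : R[i] := ((pi : R)%:C)%C * 'i.

Lemma cpi_neq0 : cpi != 0.
Proof.
by rewrite mulf_neq0 ?neq0Ci// (inj_eq (@complexI R)) gt_eqF// pi_gt0.
Qed.

Lemma conj_cpi : cpi^* = - cpi.
Proof. by rewrite /cpi conjCM conjC_real conjCi mulrN. Qed.

Definition Gam z : bop X (YY Y) :=
  bpair (P z) (bscale cpi^-1 (bcomp (bproj Y) (tau z))).

Lemma GamE z f : Gam z f = (P z f, cpi^-1 *: ortho_proj Y (tau z f)).
Proof. by []. Qed.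

Lemma Gam_resolvent l m f : Om l -> Om m ->
  Gam l f = Gam m f + (l - m) *: Gam l (tau m f).
Proof.
move=> Ol Om'; rewrite !GamE {1}(P_resolvent f Ol Om') {1}(tau_resolvent f Ol Om').
congr pair; rewrite -[ortho_proj Y (_ + _)]/(bproj Y _) linearD linearZ /=.
by rewrite scalerDr !scalerA mulrC.
Qed.

Lemma Gam_val z (y : sub_hilbert Y) : Om z -> Gam z (\val y) = (y, 0).
Proof.
move=> Oz; have [PE tE] := Ptau_val y Oz; rewrite GamE PE tE.
by rewrite -[ortho_proj Y 0]/(bproj Y 0) linear0 scaler0.
Qed.

(** Write P_w g = g - (E - w I) tau_w g and likewise P_m f: the terms in [E] cancel by symmetry
    because conj(1 / (pi i)) = - 1 / (pi i) gives the two halves opposite signs. *)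
Lemma lagrange m w f g : Om m -> Om w ->
  '[J1 (Gam m f), Gam w g] = cpi^-1 *
    ('[tau m f, g] - '[f, tau w g] + (w^* - m) * '[tau m f, tau w g]).
Proof.
move=> Om' Ow; rewrite ip_hsum /= ipZl ipZr.
rewrite ortho_proj_ip (ipC _ (ortho_proj _ _)) ortho_proj_ip -ipC.
have -> : \val (P w g) = g - (E (tau w g) - w *: tau w g).
  by rewrite -{2}(PtauP g Ow) addrAC subrr add0r.
have -> : \val (P m f) = f - (E (tau m f) - m *: tau m f).
  by rewrite -{2}(PtauP f Om') addrAC subrr add0r.
rewrite !(ipBr, ipBl, ipZl, ipZr) (E_symmetric (tau_dom f Om') (tau_dom g Ow)).
have -> : cpi^-1^* = - cpi^-1 by rewrite fmorphV /= conj_cpi invrN.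
ring.
Qed.

Lemma Om_nbhs (z : R[i]) : Om z -> exists2 d : R, 0 < d & forall w : R[i], rn (w - z) < d -> Om w.
Proof.
move=> Oz; have : nbhs (z : R[i]^o) Om by exact: open_nbhs_nbhs.
move=> /nbhs_ballP[_ /gt0_real_complex[d d0 ->] dO]; exists d => // w wz.
apply: dO; rewrite -ball_normE.
by have : `|z - w| < (d%:C)%C by rewrite rnE ltcR rnBC.
Qed.

(** The resolvent identity bounds |tau_w f| by |tau_z f| plus half of |tau_w f|, and the half is
    absorbed. All local uniformity in the point rests on this estimate. *)
Lemma tau_local_bound z (M : R) : Om z -> 0 < M -> (forall f, rn (tau z f) <= M * rn f) ->
  forall w f, Om w -> rn (w - z) * M <= 2^-1 -> rn (tau w f) <= 2 * rn (tau z f).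
Proof.
move=> Oz M0 MP w f Ow wz.
have := tau_resolvent f Oz Ow; rewrite -opprB scaleNr => /eqP.
rewrite eq_sym subr_eq => /eqP E'.
have := rnD (tau z f) ((w - z) *: tau z (tau w f)); rewrite -E' rnZ.
have : rn (w - z) * rn (tau z (tau w f)) <= rn (w - z) * M * rn (tau w f).
  by rewrite -mulrA ler_wpM2l ?rn_ge0.
have : rn (w - z) * M * rn (tau w f) <= 2^-1 * rn (tau w f) by rewrite ler_wpM2r ?rn_ge0.
lra.
Qed.

(** By the decomposition at z, these are the vectors lying in rng(E - z I) for every z in [Om]. *)
Definition unobservable : set X := [set f | forall z, Om z -> P z f = 0].

Lemma unobservable_subspace : is_subspace unobservable.
Proof.
split=> [z _|a f g f0 g0 z Oz]; first by rewrite linear0.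
by rewrite linearP /= f0// g0// scaler0 addr0.
Qed.

Lemma unobservable_closed : closed unobservable.
Proof.
move=> f /closure_seq[u u0 uf] z Oz.
have /rn_cvg_seqP Pu := bop_cvg (T := P z) uf.
apply: rn_eq0; apply/eqP; rewrite eq_le rn_ge0 andbT.
apply: le0_eps => e /Pu[N /(_ N (leqnn N))].
by rewrite (u0 N z Oz) sub0r rnN => /ltW.
Qed.

(** For w different from z, the resolvent identity gives (w - z) P_w tau_z f = 0. At w = z the value
    is (z - x) P_z tau_x tau_z f for any x in [Om] other than z, and this tends to 0 as x tends to
    z. *)
Lemma unobservable_tau z f : Om z -> unobservable f -> unobservable (tau z f).
Proof.
move=> Oz f0.
have ne w : Om w -> w != z -> P w (tau z f) = 0.
  move=> Ow wz; have := P_resolvent f Ow Oz; rewrite !f0// add0r => /esym/eqP.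
  by rewrite scaler_eq0 subr_eq0 (negbTE wz) => /eqP.
move=> w Ow; have [->|/ne] := eqVneq w z; last exact.
apply: rn_eq0; apply/eqP; rewrite eq_le rn_ge0 andbT; apply: le0_eps => e e0.
have [d d0 dO] := Om_nbhs Oz.
have [M M0 MP] := bop_bound (tau z); have [N N0 NP] := bop_bound (P z).
pose C := 2 * N * rn (tau z (tau z f)) + 1.
have C0 : 0 < C by rewrite /C; have := mulr_ge0 (ltW N0) (rn_ge0 (tau z (tau z f))); lra.
(* The three terms keep [x] in [Om], bring the final estimate below [e], and meet the condition of
   [tau_local_bound]. *)
pose r := Num.min (d / 2) (Num.min (e / C) ((2 * M)^-1)).
have r0 : 0 < r by rewrite !lt_min !divr_gt0//= invr_gt0 mulr_gt0.
have rd : r < d by rewrite (@le_lt_trans _ _ (d / 2)) ?ge_min ?lexx// ; lra.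
have re : r * C <= e by rewrite -ler_pdivlMr// !ge_min lexx orbT.
have rM : r * M <= 2^-1.
  by rewrite -ler_pdivlMr// -invfM !ge_min lexx !orbT.
pose x : R[i] := z + (r%:C)%C.
have xz : rn (x - z) = r by rewrite /x addrAC subrr add0r rnC gtr0_norm.
have Ox : Om x by apply: dO; rewrite xz.
have nx : x != z.
  rewrite -subr_eq0; apply/eqP => E'; move: r0; rewrite -xz E' rn0 ltxx//.
have := P_resolvent (tau z f) Oz Ox; rewrite (ne _ Ox nx) add0r => ->.
rewrite rnZ rnBC xz; apply: le_trans re; rewrite ler_wpM2l ?(ltW r0)//.
rewrite (le_trans (NP _))// /C.
have := tau_local_bound Oz M0 MP (tau z f) Ox; rewrite xz => /(_ rM) le2.
have : N * rn (tau x (tau z f)) <= N * (2 * rn (tau z (tau z f))) by rewrite ler_wpM2l ?(ltW N0).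
lra.
Qed.

Definition unobservable_cs := ClosedSubspace unobservable_subspace unobservable_closed.

Lemma unobservable_decomp z f : Om z -> unobservable f -> E (tau z f) - z *: tau z f = f.
Proof. by move=> Oz f0; have := PtauP f Oz; rewrite f0// raddf0 addr0. Qed.

(** With h1 the projection of (E - l I) f, the projection of f is tau_l h1: the vector (E - l I) (f
    - tau_l h1) is orthogonal to the subspace, every k of which equals (E - conj(l) I) tau_conj(l)
    k, so symmetry makes f - tau_l h1 orthogonal to k. *)
Lemma unobservable_reducing : Om !=set0 -> reducing E unobservable_cs.
Proof.
move=> [l Ol] f Ef; set L := unobservable_cs.
pose h := E f - l *: f; pose h1 := \val (ortho_proj L h).
have h1L : unobservable h1 by exact: (cs_valP (ortho_proj L h)).
have h1E := unobservable_decomp Ol h1L.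
have Eg := tau_dom h1 Ol.
have [g gE] := @in_cs _ _ L _ (unobservable_tau Ol h1L).
have projf : ortho_proj L f = g.
  apply: ortho_proj_unique => k Lk; rewrite gE.
  rewrite -(unobservable_decomp (Om_conj Ol) Lk).
  rewrite -(symm_shift E_symmetric _ (domB E_linear Ef Eg) (tau_dom k (Om_conj Ol))).
  have -> : E (f - tau l h1) - l *: (f - tau l h1) = h - h1.
    by rewrite (opB E_linear)// -[in RHS]h1E /h; vring.
  exact: (ortho_projP h (unobservable_tau (Om_conj Ol) Lk : cs_set L _)).
rewrite projf gE; split=> //.
have -> : E (tau l h1) = h1 + l *: tau l h1 by apply/eqP; rewrite -subr_eq h1E.
have -> : E f = h + l *: f by rewrite /h subrK.
by rewrite [h + _]addrC ortho_proj_linear projf linearP /= gE addrC.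
Qed.

Lemma unobservable_part (f : sub_hilbert unobservable_cs) :
  Om !=set0 -> dom E (\val f) -> \val (part E unobservable_cs f) = E (\val f).
Proof.
move=> O0 Ef; have [_] := unobservable_reducing O0 Ef.
by rewrite ortho_proj_val => ->.
Qed.

(** Range criterion for self-adjointness: by [tauL], both E - l I and E - conj(l) I map the domain
    of the part onto the whole subspace. *)
Lemma unobservable_selfadjoint : Om !=set0 -> selfadjoint (part E unobservable_cs).
Proof.
move=> O0; have [l Ol] := O0; have Oc := Om_conj Ol; set L := unobservable_cs.
have tauL z (f : sub_hilbert L) : Om z -> exists2 g : sub_hilbert L,
    \val g = tau z (\val f) & dom E (\val g) /\ E (\val g) - z *: \val g = \val f.
  move=> Oz; have [g gE] := @in_cs _ _ L _ (unobservable_tau Oz (cs_valP f)).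
  exists g => //; rewrite gE; split; first exact: tau_dom.
  exact: unobservable_decomp Oz (cs_valP f).
split.
  apply: orth_dense.
    have v0 : \val (0 : sub_hilbert L) = 0 by exact: raddf0.
    have vP a (f g : sub_hilbert L) : \val (a *: f + g) = a *: \val f + \val g.
      exact: linearP.
    split=> [|a f g Ef Eg].
      by change (dom E (\val (0 : sub_hilbert L))); rewrite v0; exact: dom0.
    by change (dom E (\val (a *: f + g))); rewrite vP; exact: domP.
  move=> h hP; have [g _ [Eg gE]] := tauL l h Ol.
  suff g0 : g = 0.
    by apply: val_inj; rewrite -gE g0 raddf0 (op0 E_linear) scaler0 subr0.
  apply: ip_eq0 => k; have [k' _ [Ek kE]] := tauL _ k Oc.
  rewrite sub_ipE -kE -(symm_shift E_symmetric)// gE -sub_ipE.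
  exact: hP.
move=> f h; split=> [adj|[Ef <-]]; last first.
  move=> g Eg; rewrite !sub_ipE !unobservable_part//; exact: E_symmetric.
(* [f'] solves (E - conj(l) I) f' = h - conj(l) f. It pairs like [f] with every (E - l I) g', that
   is with the whole subspace, so f = f' is in the domain. *)
pose k := h - l^* *: f.
have [f' _ [Ef' f'E]] := tauL _ k Oc.
have ff' : f = f'.
  apply: ip_injr => g; have [g' _ [Eg' g'E]] := tauL _ g Ol.
  have := adj g' Eg'.
  rewrite !sub_ipE unobservable_part// => adjE.
  have -> : '[\val g, \val f'] = '[\val g', \val k].
    by rewrite -g'E (symm_shift E_symmetric)// f'E.
  by rewrite -g'E ipBl ipZl adjE /k sub_valB sub_valZ ipBr ipZr conjCK.
subst f'; split=> //; apply: val_inj; rewrite unobservable_part//.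
by apply/eqP; rewrite -(inj_eq (addIr (- (l^* *: \val f)))) f'E /k sub_valB sub_valZ.
Qed.

Lemma Gam_injective f : Om !=set0 -> (forall z, Om z -> Gam z f = 0) -> f = 0.
Proof.
move=> O0 Gf; apply: contrapT => /eqP f0; apply: E_simple; exists unobservable_cs.
split; [exact: unobservable_reducing| |exact: unobservable_selfadjoint].
by exists f => // z /Gf; rewrite GamE => -[].
Qed.

End Model.

(** * Factorization of the kernel *)

Section Kernel.
Context {R : realType}.
Variables (X K : hilbertType R) (Om : set R[i]^o) (J : bop K K).
Variables (tau : R[i] -> bop X X) (Gam : R[i] -> bop X K).
Hypothesis Om_conj : forall z : R[i], Om z -> Om z^*.
Hypothesis JK : forall u, J (J u) = u.
Hypothesis J_ip : forall u v, '[J u, v] = '[u, J v].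
Hypothesis Gam_res : forall l m f, Om l -> Om m ->
  Gam l f = Gam m f + (l - m) *: Gam l (tau m f).
Hypothesis Gam_lagrange : forall m w f g, Om m -> Om w ->
  '[J (Gam m f), Gam w g] = (cpi : R[i])^-1 *
    ('[tau m f, g] - '[f, tau w g] + (w^* - m) * '[tau m f, tau w g]).

Definition Nk l w : bop K K :=
  badd J (bscale (cpi * (l - w^*)) (bcomp (Gam l) (badj (Gam w)))).

Lemma NkE l w u : Nk l w u = J u + (cpi * (l - w^*)) *: Gam l (badj (Gam w) u).
Proof. by []. Qed.

Lemma Nk_ip l w u v : '[Nk l w u, v] = '[u, Nk w l v].
Proof.
rewrite !NkE ipDl ipDr J_ip ipZl ipZr badjP badjPl; congr (_ + _ * _).
by rewrite conjCM conjCB conjCK conj_cpi mulNr -mulrN opprB.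
Qed.

Lemma Nk_conj l u : Nk l l^* u = J u.
Proof. by rewrite NkE conjCK subrr mulr0 scale0r addr0. Qed.

Lemma badjGam_res w m u : Om w -> Om m ->
  badj (Gam w) u = badj (Gam m) u + (w - m)^* *: badj (tau m) (badj (Gam w) u).
Proof.
move=> Ow Om'; apply: ip_injr => f.
by rewrite ipDr ipZr conjCK -!badjP (Gam_res f Ow Om') ipDl ipZl.
Qed.

Lemma badjGam_Nk m w u : Om m -> Om w ->
  badj (Gam m^*) (J (Nk m w u)) =
  badj (Gam w) u + (m - w^*) *: tau m (badj (Gam w) u).
Proof.
move=> Om' Ow; have Omc := Om_conj Om'.
set x := badj (Gam w) u.
have xE : badj (Gam m^*) u = x - (w - m^*)^* *: badj (tau m^*) x.
  by rewrite {1}/x (badjGam_res u Ow Omc) addrK.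
have GJG : badj (Gam m^*) (J (Gam m x)) = cpi^-1 *: (tau m x - badj (tau m^*) x).
  apply: ip_inj => f; rewrite badjPl (Gam_lagrange _ _ Om' Omc) conjCK subrr mul0r addr0.
  by rewrite ipZl ipBl badjPl.
have JE : J (Nk m w u) = u + (cpi * (m - w^*)) *: J (Gam m x).
  by rewrite NkE (linearD J) (linearZ_LR J) JK.
rewrite JE (linearD (badj _)) (linearZ_LR (badj _)) xE GJG conjCB conjCK.
by vring; field; exact: cpi_neq0.
Qed.

(** The resolvent identity turns (l - m) Gam_l tau_m into Gam_l - Gam_m, after which the
    coefficients of Gam_l add up to those of N(l, w). *)
Lemma Nk_mul l m w u : Om l -> Om m -> Om w ->
  Nk l m^* (J (Nk m w u)) = Nk l w u.
Proof.
move=> Ol Om' Ow; rewrite [LHS]NkE JK conjCK badjGam_Nk// !NkE.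
set x := badj (Gam w) u.
rewrite (linearD (Gam l)) (linearZ_LR (Gam l)) (Gam_res x Ol Om').
by vring.
Qed.


(** * Block factorization of N(m, m), with K in coordinates H + H swapped by J *)

Variables (H : hilbertType R) (i1 i2 : bop H K) (p1 p2 : bop K H) (iota : H -> X).
Hypothesis i1_ip : forall h u, '[i1 h, u] = '[h, p1 u].
Hypothesis i2_ip : forall h u, '[i2 h, u] = '[h, p2 u].
Hypothesis ipE : forall u, i1 (p1 u) + i2 (p2 u) = u.
Hypothesis p1i1 : forall h, p1 (i1 h) = h.
Hypothesis p2i2 : forall h, p2 (i2 h) = h.
Hypothesis p1i2 : forall h, p1 (i2 h) = 0.
Hypothesis p2i1 : forall h, p2 (i1 h) = 0.
Hypothesis Ji1 : forall h, J (i1 h) = i2 h.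
Hypothesis Ji2 : forall h, J (i2 h) = i1 h.
Hypothesis iota_rn : forall h, rn (iota h) = rn h.
Hypothesis Gam_iota : forall z h, Om z -> Gam z (iota h) = i1 h.

(** Since Gam(z) maps the isometric copy iota h of h to i1 h, Cauchy-Schwarz applies to |h|^2 =
    <iota h, Gam(z)^* i1 h>. *)
Lemma rn_le_badj z (h : H) : Om z -> rn h <= rn (badj (Gam z) (i1 h)).
Proof.
move=> Oz; have [->|/rn_gt0 h0] := eqVneq h 0; first by rewrite rn0 rn_ge0.
rewrite -(ler_pM2l h0); have := cauchy_schwarz (iota h) (badj (Gam z) (i1 h)).
by rewrite -badjP Gam_iota// i1_ip p1i1 iota_rn ipxx rnC ger0_norm ?sqr_ge0.
Qed.

(** For k = 2 pi Im m this is the (1,1) block of - N(m, m) when z = m and of N(conj m, conj m) when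
    z = conj m, as pi i (m - conj m) = - k and J has no diagonal blocks. *)
Definition block (k : R) z : bop H H :=
  bscale (k%:C)%C (bcomp p1 (bcomp (Gam z) (bcomp (badj (Gam z)) i1))).

Lemma blockE k z h : block k z h = (k%:C)%C *: p1 (Gam z (badj (Gam z) (i1 h))).
Proof. by []. Qed.

Lemma block_ip k z h h' :
  '[block k z h, h'] = (k%:C)%C * '[badj (Gam z) (i1 h), badj (Gam z) (i1 h')].
Proof. by rewrite blockE ipZl ipC -i1_ip -ipC badjP. Qed.

Lemma block_selfadj k z : selfadj (block k z).
Proof.
move=> h h'; rewrite block_ip [RHS]ipC block_ip conjCM conjC_real.
by congr (_ * _); rewrite -ipC.
Qed.

Lemma block_coercive (k : R) z h : Om z -> 0 < k ->
  k * rn h ^+ 2 <= complex.Re '[block k z h, h].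
Proof.
move=> Oz k0; rewrite block_ip ReCM ipxx /= ler_pM2l//.
by rewrite ler_pXn2r ?nnegrE ?rn_ge0// rn_le_badj.
Qed.

Lemma Nk_factor_pos m : Om m -> 0 < complex.Im m -> exists C : bop K K,
  (forall u, C u = 0 -> u = 0) /\ forall u, C (J (badj C u)) = Nk m m u.
Proof.
move=> Om' m0; have Omc := Om_conj Om'.
pose k : R := 2 * pi * complex.Im m.
have k0 : 0 < k by rewrite !mulr_gt0 ?pi_gt0.
have kE : cpi * (m - m^*) = - (k%:C)%C.
  rewrite /cpi /k -complexiE; case: (m) => x y /=.
  by apply/eqP; rewrite eq_complex /=; apply/andP; split; apply/eqP; ring.
have kE' : cpi * (m^* - m^*^*) = (k%:C)%C by rewrite conjCK -opprB mulrN kE opprK.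
pose a := block k m; pose e := block k m^*.
have [r [q [sr sq rar rq qr]]] :=
  inverse_sqrt k0 (fun h => block_coercive h Om' k0) (@block_selfadj k m).
have [s [p [ss sp ses spK psK]]] :=
  inverse_sqrt k0 (fun h => block_coercive h Omc k0) (@block_selfadj k m^*).
rewrite -/a in rar; rewrite -/e in ses.
have N1 h : p1 (Nk m m (i1 h)) = - a h.
  by rewrite NkE kE Ji1 (linearD p1) p1i2 add0r (linearZ_LR p1) /a blockE scaleNr.
have N'1 h : p1 (Nk m^* m^* (i1 h)) = e h.
  by rewrite NkE kE' Ji1 (linearD p1) p1i2 add0r (linearZ_LR p1) /e blockE.
have N'N u : Nk m^* m^* (J (Nk m m u)) = J u.
  by have := Nk_conj m^* u; rewrite conjCK => <-; exact: Nk_mul.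
have arr z : a (r (r z)) = z by rewrite -(qr (a _)) rar qr.
have sse z : s (s (e z)) = z by rewrite -{1}(spK z) -{2}(spK z) ses spK.
have qar z : a (r z) = q z by rewrite -(qr (a _)) rar.
(* These coordinates diagonalize J: x1 J x1^* = -1, x2 J x2^* = 1 and x1 J x2^* = 0. So C J C^* is
   the sum of - N i1 a^-1 p1 N and i2 e^-1 p2, where N = N(m, m). *)
pose x1 := badd p1 (bscale (- 2^-1) p2); pose x2 := badd p1 (bscale 2^-1 p2).
pose C : bop K K := badd (bcomp (Nk m m) (bcomp i1 (bcomp r x1))) (bcomp i2 (bcomp s x2)).
have x1E u : x1 u = p1 u - 2^-1 *: p2 u by rewrite -scaleNr.
have x2E u : x2 u = p1 u + 2^-1 *: p2 u by [].
have CE u : C u = Nk m m (i1 (r (x1 u))) + i2 (s (x2 u)) by [].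
have CA v : badj C v = i1 (r (p1 (Nk m m v)) + s (p2 v)) +
    i2 (2^-1 *: (s (p2 v) - r (p1 (Nk m m v)))).
  apply: ip_injr => u; rewrite -badjP CE ipDl Nk_ip i1_ip i2_ip sr ss x1E x2E.
  rewrite ipDr (ipC u (i1 _)) (ipC u (i2 _)) i1_ip i2_ip -!ipC.
  rewrite !(ipDl, ipDr, ipBl, ipBr, ipNl, ipNr, ipZl, ipZr).
  by rewrite fmorphV rmorph_nat; ring.
have half (a1 b1 : H) : [/\ 2^-1 *: (b1 - a1) - 2^-1 *: (a1 + b1) = - a1 &
    2^-1 *: (b1 - a1) + 2^-1 *: (a1 + b1) = b1] by split; vring; field.
exists C; split=> u.
  rewrite CE => f0.
  have := congr1 p1 f0; rewrite (linearD p1) N1 p1i2 addr0 linear0 qar => /eqP.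
  rewrite oppr_eq0 => /eqP q0.
  have x10 : x1 u = 0 by rewrite -[LHS](rq) q0 linear0.
  have := congr1 p2 f0; rewrite x10 !linear0 add0r p2i2 => s0.
  have x20 : x2 u = 0 by rewrite -[LHS](psK) s0 linear0.
  have u1 : p1 u = 0.
    have -> : p1 u = 2^-1 *: (x1 u + x2 u) by rewrite x1E x2E; vring; field.
    by rewrite x10 x20 addr0 scaler0.
  have u2 : p2 u = 0.
    have -> : p2 u = x2 u - x1 u by rewrite x1E x2E; vring; field.
    by rewrite x10 x20 subr0.
  by rewrite -(ipE u) u1 u2 !linear0 addr0.
rewrite CA; have [z zN] : {z | z = Nk m m u} by exists (Nk m m u).
rewrite -zN CE (linearD J) Ji1 Ji2 x1E x2E.
rewrite !(linearD p1) !(linearD p2) !p1i1 !p1i2 !p2i1 !p2i2 !addr0 !add0r.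
have [-> ->] := half (r (p1 z)) (s (p2 u)).
(* [w] is the vector of the first summand for which N(m, m) w has the same first component as [z];
   the remainder [h] is the Schur complement applied to p2 u. *)
pose w : K := i1 (- r (r (p1 z))); pose h := p2 (z - Nk m m w).
have zE : z = Nk m m w + i2 h.
  rewrite -[LHS](subrK (Nk m m w)) addrC; congr (_ + _).
  rewrite -[LHS]ipE -/h [X in i1 X](_ : _ = 0) ?linear0 ?add0r//.
  by rewrite (linearB p1) /w N1 (linearN a) opprK arr subrr.
(* J N(conj m, conj m) J inverts N(m, m); applied to z = N(m, m) w + i2 h and read in the second
   component, it gives p2 u = e h. *)
have u2E : p2 u = e h.
  have : J (Nk m^* m^* (J z)) = u by rewrite zN N'N JK.
  rewrite zE (linearD J (Nk m m w)) (linearD (Nk m^* m^*) (J _)) N'N Ji2.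
  rewrite (linearD J (J w)) JK => <-; rewrite (linearD p2) /w p2i1 add0r -N'1.
  by apply: ip_injr => h'; rewrite -i2_ip -J_ip Ji2 i1_ip.
by rewrite u2E sse (linearN r) -/w -zE.
Qed.

End Kernel.

(** * Compactness *)

Section Orthonormal.
Context {R : realType}.
Implicit Types H : hilbertType R.

Definition orthonormal H (e : nat -> H) := forall i j, '[e i, e j] = (i == j)%:R.

Lemma orthonormal_rn H (e : nat -> H) n : orthonormal e -> rn (e n) = 1.
Proof.
move=> eP; have := eP n n; rewrite eqxx ipxx => /(congr1 (@complex.Re R)) /= /eqP.
by rewrite sqrf_eq1 => /orP[/eqP//|/eqP E]; have := rn_ge0 (e n); rewrite E; lra.
Qed.

(** Gram-Schmidt: [f] extends a finite orthonormal list by one vector. If this failed for a list,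
    every vector would equal its expansion along it, making H finite dimensional. *)
Lemma orthonormal_sequence H : ~ finite_dim [set: H] -> exists e : nat -> H, orthonormal e.
Proof.
move=> nfin.
pose ons (s : seq H) := forall i j, (i < size s)%N -> (j < size s)%N ->
  '[nth 0 s i, nth 0 s j] = (i == j)%:R.
have /choice[f fP] : forall s : seq H, exists v : H, ons s ->
    '[v, v] = 1 /\ forall i, (i < size s)%N -> '[v, nth 0 s i] = 0.
  move=> s; have [sP|] := pselect (ons s); last by exists 0.
  apply: contrapT => nv; apply: nfin.
  exists (size s), (fun i => nth 0 s i) => x _; exists (fun i => '[x, nth 0 s i]).
  apply: contrapT => /eqP; rewrite -subr_eq0; set y := _ - _ => y0.
  have ys i : (i < size s)%N -> '[y, nth 0 s i] = 0.
    move=> si; rewrite ipBl ip_suml (bigD1 (Ordinal si))//= big1 => [|j ji].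
      by rewrite ipZl sP// eqxx mulr1 addr0 subrr.
    by rewrite ipZl sP// (_ : _ == _ = false) ?mulr0//; apply: negbTE.
  apply: nv; exists (((rn y)^-1%:C)%C *: y) => _; split=> [|i /ys yi]; last first.
    by rewrite ipZl yi mulr0.
  rewrite ipxx rnZ rnC ger0_norm ?invr_ge0 ?rn_ge0// mulVf ?expr1n//.
  by rewrite gt_eqF// rn_gt0.
pose ss n := iter n (fun s => rcons s (f s)) [::].
have sz n : size (ss n) = n by elim: n => //= n IH; rewrite size_rcons IH.
have ssP n : ons (ss n).
  elim: n => [|n IH] i j; rewrite ?sz// => Hi Hj /=; rewrite !nth_rcons sz.
  have [f1 f0] := fP _ IH.
  have [ilt|ige] := ltnP i n; have [jlt|jge] := ltnP j n.
  - by apply: IH; rewrite sz.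
  - have -> : j = n by apply/eqP; rewrite eqn_leq jge -ltnS Hj.
    by rewrite eqxx (ltn_eqF ilt) ip_eq0C ?f0 ?sz.
  - have -> : i = n by apply/eqP; rewrite eqn_leq ige -ltnS Hi.
    by rewrite eqxx (gtn_eqF jlt) f0 ?sz.
  - have -> : i = n by apply/eqP; rewrite eqn_leq ige -ltnS Hi.
    have -> : j = n by apply/eqP; rewrite eqn_leq jge -ltnS Hj.
    by rewrite !eqxx f1.
have nthss n i : (i < n)%N -> nth 0 (ss n) i = f (ss i).
  elim: n => // n IH; rewrite ltnS leq_eqVlt /= nth_rcons sz => /orP[/eqP ->|ilt].
    by rewrite ltnn eqxx.
  by rewrite ilt IH.
exists (fun n => f (ss n)) => i j.
have orth a b : (a < b)%N -> '[f (ss b), f (ss a)] = 0.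
  by move=> ab; rewrite -(nthss _ _ ab); apply: (fP _ (ssP b)).2; rewrite sz.
have [ij|ji|->] := ltngtP i j; last by rewrite (fP _ (ssP j)).1.
- by rewrite ip_eq0C// orth.
- by rewrite orth.
Qed.

Lemma infinitely_often_injection (Q : nat -> Prop) :
  (forall N, exists k, (N <= k)%N /\ Q k) ->
  exists g : nat -> nat, injective g /\ forall j, Q (g j).
Proof.
move=> /choice[h hP]; pose g n := iter n (fun m => h m.+1) (h 0%N).
have gS n : (g n < g n.+1)%N by have [] := hP (g n).+1.
exists g; split=> [|[|j]]; [|exact: (hP _).2..].
have gmono : {homo g : i j / (i < j)%N} by apply: homo_ltn => // ? ? ?; exact: ltn_trans.
move=> i j gij; have [/gmono|/gmono|//] := ltngtP i j; by rewrite gij ltnn.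
Qed.

Lemma bounded_op_real H (T : H -> H) : bounded_op T ->
  exists M : R, forall u, rn (T u) <= M * rn u.
Proof.
move=> [_ [M MP]]; exists (complex.Re M) => u; have := MP u.
by rewrite !rnE mulrC lecE ReCM => /andP[_]; rewrite mulrC.
Qed.

Lemma bounded_opP H (T : bop H H) : bounded_op T.
Proof.
split; first exact: linearP.
by have [M M0 MP] := bop_bound T; exists (M%:C)%C => u; rewrite !rnE -CM lecR.
Qed.

Lemma compact_cluster H (T : H -> H) (u : nat -> H) : compact_op T ->
  (forall n, rn (u n) <= 1) -> exists v, forall (e : R) (N : nat), 0 < e ->
    exists j, (N <= j)%N /\ rn (T (u j) - v) < e.
Proof.
move=> [_]; rewrite precompactE => cT u1.
have FF : ProperFilter ((fun j => T (u j)) @ \oo) by exact: fmap_proper_filter.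
have [|v [_ vP]] := cT _ FF.
  exists 0%N => // j _; apply: subset_closure; exists (u j) => //=.
  by rewrite rnE -[1]/((1 : R)%:C%C) lecR.
exists v => e N e0.
have e0' : 0 < (e%:C)%C by rewrite ltcR.
have [|_ [[j Nj <-]]] := vP [set T (u j) | j in [set j | (N <= j)%N]] _ _
    (nbhsx_ballx v _ e0').
  by exists N => // j Nj; exists j.
rewrite -ball_normE /= rnE ltcR rnBC => jv; by exists j.
Qed.

(** Compactness yields infinitely many T h_j within d / 4 of one v with |v| >= 3 d / 4. The sum of n
    such h_j has norm sqrt n, but its image is within n d / 4 of n v and so has norm at least n d /
    2, against boundedness for large n. *)
Lemma compact_orthonormal H (T : H -> H) (f : nat -> H) (d : R) : 0 < d ->
  compact_op T -> orthonormal f ->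
  ~ forall N, exists k, (N <= k)%N /\ d <= rn (T (f k)).
Proof.
move=> d0 cT fP often.
have [M MP] := bounded_op_real cT.1.
pose T' := mk_bop cT.1.1 (ex_intro _ M MP).
have [g [ginj gP]] := infinitely_often_injection often.
have [v vP] := compact_cluster (u := f \o g) cT
  (fun n => eq_ind_r (fun r : R => r <= 1) (lexx 1) (orthonormal_rn (g n) fP)).
have d4 : 0 < d / 4 by lra.
have [g2 [g2inj g2P]] := infinitely_often_injection (fun N => vP _ N d4).
pose h j := f (g (g2 j)).
have hP i j : '[h i, h j] = (i == j)%:R.
  by rewrite fP (inj_eq ginj) (inj_eq g2inj).
have rv : 3 * d / 4 <= rn v.
  have := gP (g2 0%N); have := g2P 0%N; have := rn_dist (T (f (g (g2 0%N)))) v.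
  by rewrite /=; lra.
pose x n := \sum_(j < n) h j.
have xh n j : (n <= j)%N -> '[x n, h j] = 0.
  move=> nj; rewrite ip_suml big1// => i _; rewrite hP ltn_eqF//.
  exact: leq_trans nj.
have xn n : rn (x n) ^+ 2 = n%:R.
  elim: n => [|n IH]; first by rewrite /x big_ord0 rn0 expr0n.
  rewrite /x big_ord_recr /= rn_sqrD_orth ?xh// IH.
  have : rn (h n) = 1 by exact: orthonormal_rn.
  by move=> ->; rewrite expr1n -natr1.
have Tx n : rn (T' (x n) - n%:R *: v) <= n%:R * (d / 4).
  elim: n => [|n IH]; first by rewrite /x big_ord0 linear0 scale0r subr0 rn0 mul0r.
  rewrite /x big_ord_recr /= -[T _]/(T' _) linearD -natr1 scalerDl scale1r opprD addrACA.
  rewrite (le_trans (rnD _ _))// -natr1 mulrDl mul1r lerD//; exact/ltW/g2P.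
have key n : (0 < n)%N -> n%:R * (d ^+ 2 / 4) <= M ^+ 2.
  move=> n0; have n0' : 0 < n%:R :> R by rewrite ltr0n.
  have rnn : rn (n%:R : R[i]) = n%:R by rewrite -(rmorph_nat (@real_complex R)) rnC ger0_norm.
  have := rn_dist (n%:R *: v) (T' (x n)); rewrite rnBC rnZ rnn => le1.
  have := Tx n; have := MP (x n); rewrite -[T _]/(T' _) => le2 le3.
  have le4 : n%:R * (3 * d / 4) <= n%:R * rn v by rewrite ler_pM2l.
  have le5 : n%:R * (d / 2) <= M * rn (x n) by lra.
  have : (n%:R * (d / 2)) ^+ 2 <= (M * rn (x n)) ^+ 2.
    have nd : 0 <= n%:R * (d / 2) by rewrite mulr_ge0 ?ler0n//; lra.
    by rewrite ler_pXn2r ?nnegrE// (le_trans nd).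
  rewrite [(M * _) ^+ 2]exprMn xn (_ : (_ * (d / 2)) ^+ 2 = n%:R * (d ^+ 2 / 4) * n%:R).
    by rewrite ler_pM2r.
  by field.
have [n nP] : exists n : nat, M ^+ 2 / (d ^+ 2 / 4) < n%:R.
  by exists (Num.truncn (M ^+ 2 / (d ^+ 2 / 4))).+1; rewrite truncnS_gt.
have n0 : (0 < n)%N.
  by rewrite -(ltr0n R); apply: le_lt_trans nP; rewrite !(divr_ge0, sqr_ge0).
have := key n n0; rewrite leNgt -ltr_pdivrMr ?nP// divr_gt0 ?exprn_gt0//.
Qed.

Lemma bounded_val H (L : closed_subspace H) :
  exists M : R, forall y : sub_hilbert L, rn (\val y) <= M * rn y.
Proof. by exists 1 => y; rewrite mul1r. Qed.

(* [A] fixes or kills each block of the basis, whichever makes it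
   differ from [w n] on infinitely many vectors of the n-th one. *)
Lemma diagonal_projection H (e : nat -> H) (w : nat -> H -> H) : orthonormal e ->
  exists A : bop H H, selfadj A /\ forall n N, exists k, (N <= k)%N /\
    2^-1 <= rn (w n (e (pickle (n, k))) - A (e (pickle (n, k)))).
Proof.
(* [pickle] splits the sequence into countably many disjoint infinite blocks, one for each [n]. *)
move=> eP; pose b (n k : nat) := e (pickle (n, k)).
pose Q n := forall N, exists k, (N <= k)%N /\ 2^-1 <= rn (w n (b n k)).
pose A0 : set H := [set x | forall n k, Q n -> '[x, b n k] = 0].
have sA : is_subspace A0.
  split=> [n k _|a x y xA yA n k Qn]; first by rewrite ip0l.
  by rewrite ipDl ipZl xA// yA// mulr0 addr0.
have cA : closed A0.
  by move=> x /closure_seq[u uA ux] n k Qn; apply: (cvg_ip ux) => m; exact: uA.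
pose L := ClosedSubspace sA cA.
have lval : linear (\val : sub_hilbert L -> H) by move=> a x y; rewrite linearP.
pose A := bcomp (mk_bop lval (bounded_val L)) (bproj L).
have AE x : A x = \val (ortho_proj L x) by [].
exists A; split.
  move=> x y; rewrite !AE -ortho_proj_ip [LHS]ipC -[in LHS]ortho_proj_ip.
  by rewrite -ipC.
move=> n N; have [Qn|] := pselect (Q n).
  have [k [Nk kP]] := Qn N; exists k; split=> //.
  have v0 : \val (0 : sub_hilbert L) = 0 by exact: raddf0.
  have p0 : ortho_proj L (b n k) = 0.
    by apply: ortho_proj_unique => l Ll; rewrite v0 subr0; exact/ip_eq0C/Ll.
  by rewrite AE -/(b n k) p0 v0 subr0.
move=> nQ; have [N0 N0P] : exists N0, forall k, (N0 <= k)%N -> rn (w n (b n k)) < 2^-1.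
  apply: contrapT => nN0; apply: nQ => N0; apply: contrapT => nk; apply: nN0.
  by exists N0 => k Nk; rewrite ltNge; apply/negP => le2; apply: nk; exists k.
exists (maxn N N0); split; first exact: leq_maxl.
set k := maxn N N0; have := N0P k (leq_maxr _ _).
have bL : cs_set L (b n k).
  move=> n' k' Qn'; rewrite eP (inj_eq (pcan_inj pickleK)) xpair_eqE.
  have [nn'|//] := eqVneq n n'; exfalso; apply: nQ; rewrite nn'; exact: Qn'.
have [y yE] := in_cs bL.
rewrite AE -/(b n k) -{3}yE ortho_proj_val yE.
have : rn (b n k) = 1 by exact: (orthonormal_rn _ eP).
have := rn_dist (b n k) (w n (b n k)); rewrite rnBC.
lra.
Qed.

Lemma dense_sequence : exists q : nat -> R[i],
  forall (z : R[i]) (d : R), 0 < d -> exists n, rn (q n - z) < d.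
Proof.
pose q (n : nat) : R[i] := if @unpickle (rat * rat)%type n is Some ab
  then (ratr ab.1)%:C%C + 'i * (ratr ab.2)%:C%C else 0.
exists q => z d d0.
have rat_near (x : R) : exists a : rat, `|ratr a - x| < d / 2.
  have [a] := @rat_in_itvoo R (x - d / 2) (x + d / 2) ltac:(lra).
  by rewrite in_itv /= => /andP[? ?]; exists a; rewrite ltr_norml; lra.
have [a aP] := rat_near (complex.Re z); have [c cP] := rat_near (complex.Im z).
exists (pickle (a, c)); rewrite /q pickleK /=.
have -> : (ratr a)%:C%C + 'i * (ratr c)%:C%C - z =
    (ratr a - complex.Re z)%:C%C + 'i * (ratr c - complex.Im z)%:C%C.
  by rewrite {1}(complexE z) !CB complexiE; ring.
rewrite (le_lt_trans (rnD _ _))// rnM !rnC.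
have -> : rn ('i : R[i]) = 1 by rewrite /rn normCi.
by rewrite mul1r; lra.
Qed.

End Orthonormal.

(** * The function U *)

Section Realization.
Context {R : realType}.
Variables (X K H : hilbertType R) (Om : set R[i]^o) (J : bop K K).
Variables (tau : R[i] -> bop X X) (Gam : R[i] -> bop X K).
Variables (i1 i2 : bop H K) (p1 p2 : bop K H) (iota : H -> X).
Hypothesis Om_nonempty : Om !=set0.
Hypothesis Om_nbhs : forall z : R[i], Om z ->
  exists2 d : R, 0 < d & forall w : R[i], rn (w - z) < d -> Om w.
Hypothesis Om_conj : forall z : R[i], Om z -> Om z^*.
Hypothesis JK : forall u, J (J u) = u.
Hypothesis J_ip : forall u v, '[J u, v] = '[u, J v].
Hypothesis tau_res : forall l m f, Om l -> Om m ->
  tau l f = tau m f + (l - m) *: tau l (tau m f).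
Hypothesis tau_local : forall z (M : R), Om z -> 0 < M ->
  (forall f, rn (tau z f) <= M * rn f) ->
  forall w f, Om w -> rn (w - z) * M <= 2^-1 -> rn (tau w f) <= 2 * rn (tau z f).
Hypothesis Gam_res : forall l m f, Om l -> Om m ->
  Gam l f = Gam m f + (l - m) *: Gam l (tau m f).
Hypothesis Gam_lagrange : forall m w f g, Om m -> Om w ->
  '[J (Gam m f), Gam w g] = (cpi : R[i])^-1 *
    ('[tau m f, g] - '[f, tau w g] + (w^* - m) * '[tau m f, tau w g]).
Hypothesis i1_ip : forall h u, '[i1 h, u] = '[h, p1 u].
Hypothesis i2_ip : forall h u, '[i2 h, u] = '[h, p2 u].
Hypothesis ipE : forall u, i1 (p1 u) + i2 (p2 u) = u.
Hypothesis p1i1 : forall h, p1 (i1 h) = h.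
Hypothesis p2i2 : forall h, p2 (i2 h) = h.
Hypothesis p1i2 : forall h, p1 (i2 h) = 0.
Hypothesis p2i1 : forall h, p2 (i1 h) = 0.
Hypothesis p2_le : forall u, rn (p2 u) <= rn u.
Hypothesis Ji1 : forall h, J (i1 h) = i2 h.
Hypothesis Ji2 : forall h, J (i2 h) = i1 h.
Hypothesis iota_rn : forall h, rn (iota h) = rn h.
Hypothesis Gam_iota : forall z h, Om z -> Gam z (iota h) = i1 h.
Hypothesis H_infinite : ~ finite_dim [set: H].

Local Notation Nk := (Nk J Gam).

(** A point in the lower half plane is exchanged for its conjugate; at a real point N(m, m) = J and
    the identity serves as [C]. *)
Lemma Nk_factor : exists (m : R[i]) (C : bop K K),
  [/\ Om m, forall u, C u = 0 -> u = 0 & forall u, C (J (badj C u)) = Nk m m u].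
Proof.
have pos m : Om m -> 0 < complex.Im m -> exists C : bop K K,
    (forall u, C u = 0 -> u = 0) /\ forall u, C (J (badj C u)) = Nk m m u.
  exact: (Nk_factor_pos Om_conj JK J_ip Gam_res Gam_lagrange i1_ip i2_ip ipE
    p1i1 p2i2 p1i2 p2i1 Ji1 Ji2 iota_rn Gam_iota).
have [m Om'] := Om_nonempty.
have [m0|m0|m0] := ltgtP 0 (complex.Im m).
- by have [C [? ?]] := pos m Om' m0; exists m, C.
- have mc0 : 0 < complex.Im m^* by move: m0; case: (m) => x y /=; rewrite oppr_gt0.
  by have [C [? ?]] := pos _ (Om_conj Om') mc0; exists m^*, C; split=> //; exact: Om_conj.
- have mE : m^* = m.
    by move: m0; case: (m) => x y /= y0; apply/eqP; rewrite eq_complex /= -y0 oppr0 !eqxx.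
  exists m, bid; split=> // u.
  have -> : badj bid u = u by apply: ip_injr => v; rewrite -badjP.
  by rewrite -{2}mE Nk_conj.
Qed.

(* The derivative of [Nk z w] in z. *)
Definition Nk_deriv z w : bop K K :=
  bscale cpi (bcomp (Gam z) (bcomp (badd bid (bscale (z - w^*) (tau z))) (badj (Gam w)))).

Lemma Nk_derivE z w u : Nk_deriv z w u =
  cpi *: Gam z (badj (Gam w) u + (z - w^*) *: tau z (badj (Gam w) u)).
Proof. by []. Qed.

(** Applying the resolvent identities twice gives the remainder exactly, as (l - z)^2 times an
    operator that [tau_local_bound] controls uniformly near z. Both the derivative and the norm
    continuity of U are drawn from it. *)
Lemma Nk_expand z w : Om z -> exists c d : R, [/\ 0 < c, 0 < d &
  forall l : R[i], rn (l - z) < d -> Om l /\ forall u,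
    rn (Nk l w u - Nk z w u - (l - z) *: Nk_deriv z w u) <= rn (l - z) ^+ 2 * c * rn u].
Proof.
move=> Oz; have [d d0 dO] := Om_nbhs Oz.
have [M M0 MP] := bop_bound (tau z); have [G G0 GP] := bop_bound (Gam z).
have [A A0 AP] := bop_bound (badj (Gam w)).
pose c := rn (cpi : R[i]) * (G * ((1 + rn (z - w^*) * M) * (2 * M * A))) + 1.
have c0 : 0 < c.
  rewrite ltr_wpDl// !mulr_ge0 ?rn_ge0// ?(ltW G0) ?(ltW A0) ?(ltW M0)//.
  by rewrite addr_ge0// mulr_ge0 ?rn_ge0 ?(ltW M0).
exists c, (Num.min d (2 * M)^-1); split=> //.
  by rewrite lt_min d0 invr_gt0 mulr_gt0.
move=> l; rewrite lt_min => /andP[ld lM]; have Ol := dO _ ld.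
split=> // u; set x := badj (Gam w) u.
have lM' : rn (l - z) * M <= 2^-1.
  by move: lM; rewrite invfM ltr_pdivlMr// => /ltW.
have tl := tau_local Oz M0 MP x Ol lM'.
have -> : Nk l w u - Nk z w u - (l - z) *: Nk_deriv z w u =
    (l - z) ^+ 2 *: (cpi *: Gam z (tau l x + (z - w^*) *: tau z (tau l x))).
  rewrite !NkE Nk_derivE -/x !(linearD (Gam z)) !(linearZ_LR (Gam z)).
  have GE : Gam l x = Gam z x + (l - z) *: Gam z (tau l x).
    by rewrite (Gam_res x Oz Ol); vring.
  have tE : tau l x = tau z x + (l - z) *: tau z (tau l x).
    by rewrite {1}(tau_res x Oz Ol); vring.
  have GtE : Gam z (tau z x) = Gam z (tau l x) - (l - z) *: Gam z (tau z (tau l x)).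
    by rewrite {1}tE (linearD (Gam z)) (linearZ_LR (Gam z)) addrK.
  by rewrite GE GtE; vring.
rewrite rnZ expr2 rnM -expr2 -mulrA ler_wpM2l ?sqr_ge0// rnZ.
set y := tau l x + _.
have yle : rn y <= (1 + rn (z - w^*) * M) * (2 * M * A) * rn u.
  have tx : rn (tau l x) <= 2 * M * A * rn u.
    by rewrite (le_trans tl)// -!mulrA ler_pM2l// (le_trans (MP _))// ler_pM2l//; exact: AP.
  rewrite /y (le_trans (rnD _ _))// rnZ -mulrA mulrDl mul1r lerD//.
  by rewrite -mulrA ler_wpM2l ?rn_ge0// (le_trans (MP _))// ler_pM2l.
have Gy : rn (Gam z y) <= G * ((1 + rn (z - w^*) * M) * (2 * M * A)) * rn u.
  by rewrite (le_trans (GP _))// -mulrA ler_pM2l.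
by rewrite /c mulrDl mul1r ler_wpDr ?rn_ge0// -mulrA ler_wpM2l ?rn_ge0.
Qed.

(** * The function U built from an injective J-factor of N(m, m) *)

Section Transfer.
Variables (m : R[i]) (T : bop K K).
Hypothesis Om' : Om m.
Hypothesis T_inj : forall u, T u = 0 -> u = 0.
Hypothesis TJT : forall u, T (J (badj T u)) = Nk m m u.

Definition Uop (z : R[i]) : bop K K := bcomp (Nk z m^*) (bcomp J T).

Lemma UopE z u : Uop z u = Nk z m^* (J (T u)).
Proof. by []. Qed.

Lemma badj_Uop w u : badj (Uop w) u = badj T (J (Nk m^* w u)).
Proof. by apply: ip_injr => v; rewrite -badjP UopE Nk_ip// J_ip badjP. Qed.

Lemma TJ_badj_Uop w u : Om w ->
  J (T (J (badj (Uop w) u))) = J (Nk m w u).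
Proof.
by move=> Ow; rewrite badj_Uop TJT -{2}(conjCK m) (Nk_mul Om_conj JK Gam_res Gam_lagrange)//;
  exact: Om_conj.
Qed.

Lemma Uop_kernel l w u : Om l -> Om w -> Uop l (J (badj (Uop w) u)) = Nk l w u.
Proof.
move=> Ol Ow; rewrite UopE TJ_badj_Uop//.
exact: (Nk_mul Om_conj JK Gam_res Gam_lagrange).
Qed.

Lemma Uop_right z u : Om z -> Uop z (J (badj (Uop z^*) u)) = J u.
Proof. by move=> Oz; rewrite Uop_kernel ?Nk_conj//; exact: Om_conj. Qed.

(** Here the injectivity of [T] enters: the chain rule for N gives T J T^* J N(conj m, conj m) J T =
    T, and [T] can be cancelled on the left. *)
Lemma Uop_left z u : Om z -> badj (Uop z^*) (J (Uop z u)) = J u.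
Proof.
move=> Oz; have Omc := Om_conj Om'; have Ozc := Om_conj Oz.
rewrite badj_Uop UopE.
have mul := Nk_mul Om_conj JK Gam_res Gam_lagrange.
have -> : Nk m^* z^* (J (Nk z m^* (J (T u)))) = Nk m^* m^* (J (T u)) by exact: mul.
have E : T (J (badj T (J (Nk m^* m^* (J (T u)))))) = T u.
  rewrite TJT.
  have := mul m m^* m^* (J (T u)) Om' Omc Omc; rewrite conjCK => ->.
  by rewrite Nk_conj JK.
have E2 : J (badj T (J (Nk m^* m^* (J (T u))))) = u.
  apply/eqP; rewrite -subr_eq0; apply/eqP/T_inj.
  by rewrite linearB /= E subrr.
by rewrite -{2}E2 JK.
Qed.

Lemma Uop_derive z : Om z ->
  is_op_derive (fun z => Uop z) z (bcomp (Nk_deriv z m^*) (bcomp J T)).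
Proof.
move=> Oz; split; first exact: bounded_opP.
move=> _ /gt0_real_complex[e e0 ->].
have [c [d [c0 d0 cP]]] := Nk_expand m^* Oz.
have [M M0 MP] := bop_bound (bcomp J T).
pose r := Num.min d (e / (c * M)).
have r0 : 0 < (r%:C)%C :> R[i] by rewrite ltcR lt_min d0 divr_gt0// mulr_gt0.
have near0 : \forall h \near (0 : R[i]^o)^', rn (h : R[i]) < Num.min d (e / (c * M)).
  apply: nbhs_dnbhs; apply/nbhs_ballP; exists (r%:C)%C => // h.
  rewrite -ball_normE /= => h0; have {}h0 : `|0 - h : R[i]| < (r%:C)%C by [].
  by move: h0; rewrite sub0r normrN rnE ltcR.
apply: filterS2 near0 (nbhs_dnbhs_neq (0 : R[i]^o)) => h.
rewrite lt_min => /andP[hd hr] h0 u.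
have h0' : h != 0 :> R[i] by [].
have hh : z + h - z = h by rewrite addrAC subrr add0r.
have [_ /(_ (J (T u)))] := cP (z + h) ltac:(by rewrite hh).
rewrite hh => le1.
have -> : h^-1 *: (Uop (z + h) u - Uop z u) - bcomp (Nk_deriv z m^*) (bcomp J T) u =
   h^-1 *: (Nk (z + h) m^* (J (T u)) - Nk z m^* (J (T u)) - h *: Nk_deriv z m^* (J (T u))).
  by rewrite [RHS]scalerBr scalerA mulVf// scale1r.
rewrite !rnE -CM lecR rnZ rnV.
have hp : 0 < rn h by exact: rn_gt0.
rewrite mulrC ler_pdivrMr//; apply: (le_trans le1).
move: hr; rewrite ltr_pdivlMr ?mulr_gt0// => hr.
have := MP u; rewrite -[bcomp J T u]/(J (T u)) => le2.
have le3 : rn h ^+ 2 * c * rn (J (T u)) <= rn h ^+ 2 * c * (M * rn u).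
  by rewrite ler_wpM2l// mulr_ge0 ?sqr_ge0 ?(ltW c0).
apply: (le_trans le3); rewrite (_ : _ * (M * _) = rn h * (c * M) * rn u * rn h); last by ring.
by rewrite ler_pM2r// ler_wpM2r ?rn_ge0// (ltW hr).
Qed.

(** Makes the derivative that [op_derive] picks by choice the one computed from [Nk_expand]. *)
Lemma is_op_derive_unique (U : R[i] -> K -> K) z D D' :
  is_op_derive U z D -> is_op_derive U z D' -> D = D'.
Proof.
move=> [_ DP] [_ D'P]; apply/funext => u; apply/eqP; rewrite -subr_eq0; apply/eqP/rn_eq0/eqP.
rewrite eq_le rn_ge0 andbT; apply: le0_eps => e e0.
pose e' := e / 2 / (rn u + 1).
have u1 : 0 < rn u + 1 by rewrite ltr_wpDl// rn_ge0.
have e'0 : 0 < (e'%:C)%C :> R[i] by rewrite ltcR !divr_gt0.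
have PF : ProperFilter (0 : R[i]^o)^' by exact: Proper_dnbhs_numFieldType.
have [h [/(_ u) hD /(_ u) hD']] := filter_ex (filterI (DP _ e'0) (D'P _ e'0)).
move: hD hD'; rewrite !rnE -!CM !lecR; set x := h^-1 *: _ => hD hD'.
have e'u : e' * rn u <= e / 2.
  rewrite /e' mulrAC ler_pdivrMr// ler_wpM2l ?divr_ge0 ?(ltW e0)// lerDl//.
have := rn_dist3 (D u) x (D' u); rewrite (rnBC (D u) x); lra.
Qed.

Lemma op_derive_Uop z : Om z ->
  op_derive (fun z => Uop z) z = bcomp (Nk_deriv z m^*) (bcomp J T).
Proof.
move=> Oz; apply: xget_unique; first exact: Uop_derive.
by move=> D DP; exact: is_op_derive_unique DP (Uop_derive Oz).
Qed.

Lemma adjointE (S : bop K K) : adjoint S = badj S.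
Proof.
apply/funext => v; apply: xget_unique => [u|w wP]; first exact: badjP.
by apply: ip_injr => u; rewrite -wP badjP.
Qed.

Lemma KU_Uop w z u : Om w -> Om z ->
  KU J (fun z => Uop z) w z u = 2^-1 *: Gam z (badj (Gam w) u).
Proof.
move=> Ow Oz; rewrite /KU adjointE; case: eqVneq => [zw|zw]; last first.
  rewrite Uop_kernel// NkE opprD addrA subrr add0r -scaleNr scalerA.
  congr (_ *: _); rewrite /rho -/cpi; rewrite -subr_eq0 in zw.
  rewrite (_ : 2 * _ * 'i = 2 * cpi); last by rewrite mulrA.
  by field; rewrite zw cpi_neq0.
(* On the diagonal z = conj w the correction (m - z) tau_m x from N(m, w) is cancelled by the one in
   [Nk_deriv], leaving pi i Gam(z) Gam(w)^*. *)
rewrite op_derive_Uop//= TJ_badj_Uop//.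
rewrite -[X in _ *: X]/(Nk_deriv z m^* (J (Nk m w u))) Nk_derivE.
rewrite (badjGam_Nk Om_conj JK Gam_res Gam_lagrange)// conjCK.
set x := badj (Gam w) u; rewrite -zw.
have tE : tau z x + (m - z) *: tau z (tau m x) = tau m x.
  by rewrite (tau_res x Oz Om'); vring.
rewrite (linearD (tau z)) (linearZ_LR (tau z)) tE.
have -> : x + (m - z) *: tau m x + (z - m) *: tau m x = x by vring.
rewrite scalerA (_ : 2 * _ * 'i = 2 * cpi); last by rewrite mulrA.
by congr (_ *: _); field; exact: cpi_neq0.
Qed.

Lemma Uop_admissible : admissible Om J (fun z => Uop z).
Proof.
split=> [z Oz|z Oz|z Oz u|z Oz u].
- exact: bounded_opP.
- by exists (bcomp (Nk_deriv z m^*) (bcomp J T)); exact: Uop_derive.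
- by rewrite adjointE Uop_right.
- by rewrite adjointE Uop_left.
Qed.

Lemma Uop_continuous z (e : R) : Om z -> 0 < e -> exists2 d : R, 0 < d &
  forall l, rn (l - z) < d -> Om l /\ forall u, rn (Uop l u - Uop z u) <= e * rn u.
Proof.
move=> Oz e0; have [c [d [c0 d0 cP]]] := Nk_expand m^* Oz.
have [M M0 MP] := bop_bound (bcomp J T).
have [D D0 DP] := bop_bound (Nk_deriv z m^*).
(* The bound 1 allows the quadratic remainder to be estimated by |l - z|. *)
pose r := Num.min 1 (Num.min d (e / ((c + D) * M))).
exists r; first by rewrite !lt_min ltr01 d0 divr_gt0// mulr_gt0// addr_gt0.
move=> l; rewrite !lt_min => /and3P[l1 ld le1]; have [Ol lP] := cP l ld.
split=> // u; rewrite !UopE; set v := J (T u).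
have := rn_dist (Nk l m^* v - Nk z m^* v) ((l - z) *: Nk_deriv z m^* v).
have := lP v; rewrite rnZ => le2 le3; apply: (le_trans le3).
move: le1; rewrite ltr_pdivlMr ?mulr_gt0 ?addr_gt0// => le1.
have vM : rn v <= M * rn u by exact: MP.
have q0 := rn_ge0 (l - z).
have le4 : rn (l - z) ^+ 2 * c * rn v <= rn (l - z) * c * rn v.
  by rewrite ler_wpM2r ?rn_ge0// ler_wpM2r ?(ltW c0)// expr2 ler_piMl// ltW.
have le5 : rn (l - z) * rn (Nk_deriv z m^* v) <= rn (l - z) * (D * rn v).
  by rewrite ler_wpM2l.
have le6 : rn (l - z) * (c + D) * rn v <= rn (l - z) * (c + D) * (M * rn u).
  by rewrite ler_wpM2l// mulr_ge0// addr_ge0 ?(ltW c0) ?(ltW D0).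
have le7 : rn (l - z) * ((c + D) * M) * rn u <= e * rn u.
  by rewrite ler_wpM2r ?rn_ge0// ltW.
lra.
Qed.

End Transfer.

(** * Shears and the failure of compactness *)

Definition shear (A : bop H H) : bop K K :=
  badd bid (bscale 'i (bcomp i2 (bcomp A p1))).

Lemma shearE A u : shear A u = u + 'i *: i2 (A (p1 u)).
Proof. by []. Qed.

Lemma p1_shear A u : p1 (shear A u) = p1 u.
Proof. by rewrite shearE (linearD p1) (linearZ_LR p1) p1i2 scaler0 addr0. Qed.

Lemma shear_inj A u : shear A u = 0 -> u = 0.
Proof.
move=> E; have := p1_shear A u; rewrite E linear0 => p10.
by move: E; rewrite shearE -p10 !linear0 addr0.
Qed.

Lemma p1J u : p1 (J u) = p2 u.
Proof. by apply: ip_injr => h; rewrite -i1_ip -J_ip Ji1 i2_ip. Qed.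

Lemma badj_shear (A : bop H H) v : selfadj A -> badj (shear A) v = v - 'i *: i1 (A (p2 v)).
Proof.
move=> sA; apply: ip_injr => u; rewrite -badjP shearE ipDl ipBr ipZl ipZr i2_ip.
by rewrite sA conjCi mulNr opprK (ipC u (i1 _)) i1_ip -ipC.
Qed.

Lemma shear_J (A : bop H H) u : selfadj A -> shear A (J (badj (shear A) u)) = J u.
Proof.
move=> sA; rewrite badj_shear// (linearB J) (linearZ_LR J) Ji1 shearE.
rewrite (linearB p1) (linearZ_LR p1) p1i2 scaler0 subr0 p1J.
by rewrite subrK.
Qed.

Lemma realization : exists U : R[i] -> bop K K,
  [/\ admissible Om J (fun z => U z),
   forall w z u, Om w -> Om z ->
     KU J (fun z => U z) w z u = 2^-1 *: Gam z (badj (Gam w) u) &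
   forall z, Om z -> ~ compact_op (fun u => u - U z u)].
Proof.
have [m [C [Om' Cinj CJC]]] := Nk_factor.
have [e eP] := orthonormal_sequence H_infinite.
have [q qP] := @dense_sequence R.
pose U0 := Uop m C.
(* By [Uop_left] this is a left inverse of [U0 z], so applying it to U = U0 composed with the shear
   isolates the shear. *)
pose W z := bcomp J (bcomp (badj (U0 z^*)) J).
have WE z u : W z u = J (badj (U0 z^*) (J u)) by [].
have [A [sA AP]] := diagonal_projection (fun n h => - 'i *: p2 (W (q n) (i1 h))) eP.
pose T := bcomp C (shear A).
have TE u : T u = C (shear A u) by [].
have Tinj u : T u = 0 -> u = 0 by rewrite TE => /Cinj/shear_inj.
have badjT u : badj T u = badj (shear A) (badj C u).
  by apply: ip_injr => v; rewrite -!badjP.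
have TJT u : T (J (badj T u)) = Nk m m u by rewrite badjT TE shear_J// CJC.
exists (Uop m T); split.
- exact: Uop_admissible.
- by move=> w z u; exact: KU_Uop.
move=> z Oz cT; have Ozc := Om_conj Oz.
have WU u : W z (Uop m T z u) = shear A u.
  by rewrite WE -[Uop m T z u]/(U0 z (shear A u)) (Uop_left Om' Cinj CJC)// JK.
have [M M0 MP] := bop_bound (W z).
(* Continuity is taken at conj z because W z is built from U0 there. With tolerance 1/4 the gap 1/2
   at [q n] leaves a gap 1/4 at z, and dividing by the bound [M] of W z gives a lower bound for u -
   U z u along the orthonormal [f]. *)
have [d d0 dP] := @Uop_continuous m C z^* 4^-1 Ozc ltac:(lra).
have [n nz] := qP z d d0.
have qzc : rn ((q n)^* - z^*) < d by rewrite -conjCB rn_conj.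
have [_ Uqz] := dP _ qzc.
have J_rn u : rn (J u) = rn u.
  have : rn (J u) ^+ 2 = rn u ^+ 2 by apply: (@complexI R); rewrite -!ipxx J_ip JK.
  by move=> /eqP; rewrite eqrXn2 ?rn_ge0// => /eqP.
have Wqz u : rn (W (q n) u - W z u) <= 4^-1 * rn u.
  rewrite !WE -(linearB J) J_rn -(J_rn u).
  pose Dif := badd (U0 (q n)^*) (bscale (-1) (U0 z^*)).
  have DifE v : Dif v = U0 (q n)^* v - U0 z^* v by rewrite -scaleN1r.
  have -> : badj (U0 (q n)^*) (J u) - badj (U0 z^*) (J u) = badj Dif (J u).
    by apply: ip_injr => v; rewrite -badjP DifE ipBr ipBl -!badjP.
  by apply: badj_bound => [|v]; [lra|rewrite DifE].
pose f (k : nat) := i1 (e (pickle (n, k))).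
have fP : orthonormal f.
  move=> i j; rewrite i1_ip p1i1 eP (inj_eq (pcan_inj pickleK)).
  by rewrite xpair_eqE eqxx.
apply: (@compact_orthonormal _ _ _ f (4^-1 / M) _ cT fP); first by rewrite divr_gt0//; lra.
move=> N; have [k [Nk' kP]] := AP n N; exists k; split=> //.
set x := e (pickle (n, k)) in kP *; rewrite ler_pdivrMr// mulrC.
apply: le_trans (MP _); rewrite -/(f k).
have fk1 : rn (f k) = 1 by exact: (orthonormal_rn _ fP).
have := Wqz (f k); rewrite fk1 mulr1 => Wq.
rewrite (linearB (W z)) WU.
have := p2_le (W z (f k) - shear A (f k)).
have := p2_le (W (q n) (f k) - W z (f k)).
rewrite !(linearB p2) shearE (linearD p2) (linearZ_LR p2) p2i2 {3 4}/f p2i1 p1i1 add0r -/x.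
have ri : rn ('i : R[i]) = 1 by rewrite /rn normCi.
have : 2^-1 <= rn (p2 (W (q n) (f k)) - 'i *: A x).
  apply: (le_trans kP); rewrite -[X in _ <= X]mul1r -ri -rnZ.
  suff -> : - 'i *: p2 (W (q n) (i1 x)) - A x =
      - 'i *: (p2 (W (q n) (f k)) - 'i *: A x) by rewrite scaleNr rnN.
  rewrite scalerBr scalerA mulNr -expr2 sqrCi opprK scale1r.
  by [].
have := rn_dist3 (p2 (W (q n) (f k))) (p2 (W z (f k))) ('i *: A x).
lra.
Qed.

End Realization.

(** * The space H_2 *)

Section Swap.
Context {R : realType}.
Variables (X : hilbertType R) (Y : closed_subspace X).
Local Notation H := (sub_hilbert Y).
Local Notation K := (YY Y).

Lemma J1_linear : linear (@J1 R X Y).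
Proof. by []. Qed.

Lemma J1_bounded : exists M : R, forall u : K, rn (J1 u) <= M * rn u.
Proof.
exists 2 => u; have := rn_hsum_le (J1 u); have := rn_fst_le u; have := rn_snd_le u.
by rewrite /=; lra.
Qed.

Definition bJ1 : bop K K := mk_bop J1_linear J1_bounded.

Lemma J1K (u : K) : J1 (J1 u) = u.
Proof. by case: u. Qed.

Lemma J1_ip (u v : K) : '[J1 u, v] = '[u, J1 v].
Proof. by rewrite !ip_hsum /= addrC. Qed.

Lemma J1_signature : is_signature (@J1 R X Y).
Proof.
split; first exact: (bounded_opP bJ1).
- exact: J1_ip.
- by move=> u v; rewrite J1_ip J1K.
- by move=> v; exists (J1 v); rewrite J1K.
Qed.

Definition bfst : bop K H.
Proof.
apply: (@mk_bop _ K H fst); first by [].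
by exists 1 => u; rewrite mul1r; exact: rn_fst_le.
Defined.

Definition bsnd : bop K H.
Proof.
apply: (@mk_bop _ K H snd); first by [].
by exists 1 => u; rewrite mul1r; exact: rn_snd_le.
Defined.

Definition binl : bop H K := bpair bid (bscale 0 bid).
Definition binr : bop H K := bpair (bscale 0 bid) bid.

Lemma binlE h : binl h = (h, 0) :> K.
Proof. by rewrite /binl bpairE; congr pair; rewrite /= scale0r. Qed.

Lemma binrE h : binr h = (0, h) :> K.
Proof. by rewrite /binr bpairE; congr pair; rewrite /= scale0r. Qed.

End Swap.

(** Carries infinite dimension from Y as a subset of X to Y as a Hilbert space of its own. *)
Lemma finite_dim_sub (R : realType) (X : hilbertType R) (Y : closed_subspace X) :
  finite_dim [set: sub_hilbert Y] -> finite_dim (cs_set Y).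
Proof.
move=> [n [b bP]]; exists n, (fun i => \val (b i)) => x /in_cs[y <-].
have [c ->] := bP y I; exists c; rewrite raddf_sum; apply: eq_bigr => i _.
exact: sub_valZ.
Qed.

Section H2space.
Context {R : realType}.
Variables (X : hilbertType R) (E : operator X) (Y : closed_subspace X).
Variables (Om : set R[i]^o) (tau : R[i] -> bop X X) (Gam : R[i] -> bop X (YY Y)).
Hypothesis H2_mapE : forall f (z : Om), H2_map E Y f z = Gam (\val z) f.
Hypothesis Gam_injective : forall f, (forall z, Om z -> Gam z f = 0) -> f = 0.
Hypothesis Om_nbhs : forall z : R[i], Om z ->
  exists2 d : R, 0 < d & forall w : R[i], rn (w - z) < d -> Om w.
Hypothesis tau_res : forall l m f, Om l -> Om m ->
  tau l f = tau m f + (l - m) *: tau l (tau m f).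
Hypothesis tau_local : forall z (M : R), Om z -> 0 < M ->
  (forall f, rn (tau z f) <= M * rn f) ->
  forall w f, Om w -> rn (w - z) * M <= 2^-1 -> rn (tau w f) <= 2 * rn (tau z f).
Hypothesis Gam_res : forall l m f, Om l -> Om m ->
  Gam l f = Gam m f + (l - m) *: Gam l (tau m f).

Local Notation H2_map := (@H2_map R X E Y Om).

Lemma H2_map_linear (a : R[i]) f g : H2_map (a *: f + g) = a *: H2_map f + H2_map g.
Proof.
by apply/funext => z; rewrite [RHS]/= H2_mapE linearP /= -!H2_mapE.
Qed.

Lemma H2_mapB f g : H2_map f - H2_map g = H2_map (f - g).
Proof. by rewrite [LHS]addrC -scaleN1r -H2_map_linear scaleN1r addrC. Qed.

Lemma H2_map0 : H2_map 0 = 0.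
Proof. by have := H2_mapB 0 0; rewrite !subrr => <-. Qed.

Lemma H2_map_inj : injective H2_map.
Proof.
move=> f g fg; apply/eqP; rewrite -subr_eq0; apply/eqP/Gam_injective => z Oz.
have := congr1 (fun F : Om -> YY Y => F (SigSub (mem_set Oz))) fg.
by rewrite /= !H2_mapE /= => E'; rewrite linearB /= E' subrr.
Qed.

Lemma H2_innerE f g : fs_inner (H2 E Y Om) (H2_map f) (H2_map g) = 2 * '[f, g].
Proof.
have pre h : xget 0 [set f | H2_map f = H2_map h] = h.
  by apply: xget_unique => // k /H2_map_inj.
by rewrite /= !pre.
Qed.

Lemma H2_hilbert : hilbert_function_space (H2 E Y Om).
Proof.
have two (f : X) : 2 * '[f, f] = (2 * rn f ^+ 2)%:C%C.
  by rewrite ipxx CM rmorph_nat.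
split.
- split.
    by exists 0 => //; exact: H2_map0.
  by move=> a _ _ [f _ <-] [g _ <-]; exists (a *: f + g) => //; rewrite H2_map_linear.
- move=> a _ _ _ [f _ <-] [g _ <-] [h _ <-].
  by rewrite -H2_map_linear !H2_innerE ipDl ipZl; ring.
- move=> _ _ [f _ <-] [g _ <-]; rewrite !H2_innerE conjCM -ipC.
  by rewrite rmorph_nat.
- move=> _ [f _ <-] f0; rewrite H2_innerE two ltcR mulr_gt0// exprn_gt0// rn_gt0//.
  by apply: contra_neq f0 => ->; exact: H2_map0.
- move=> u uS cau.
  have /choice[v vP] : forall n, exists v, H2_map v = u n.
    by move=> n; have [v _ vE] := uS n; exists v.
  have uv m n : fs_inner (H2 E Y Om) (u m - u n) (u m - u n) = (2 * rn (v m - v n) ^+ 2)%:C%C.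
    by rewrite -!vP H2_mapB H2_innerE two.
  have [l vl] : exists l : X, v @ \oo --> l.
    apply: (@rn_cauchy_cvg _ X) => e e0.
    have e0' : 0 < (2 * e ^+ 2)%:C%C :> R[i] by rewrite ltcR mulr_gt0// exprn_gt0.
    have [N NP] := cau _ e0'; exists N => m n Nm Nn.
    have := NP m n Nm Nn; rewrite uv ltcR ltr_pM2l//.
    by rewrite ltr_pXn2r// nnegrE ?rn_ge0// ltW.
  exists (H2_map l); first by exists l.
  move=> _ /gt0_real_complex[e e0 ->]; move/rn_cvg_seqP : vl => /(_ (Num.sqrt (e / 2))).
  case=> [|N NP]; first by rewrite sqrtr_gt0 divr_gt0.
  exists N => n Nn; rewrite -vP H2_mapB H2_innerE two ltcR mulrC -ltr_pdivlMr//.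
  rewrite -[ltRHS]sqr_sqrtr ?divr_ge0 ?(ltW e0)//.
  by rewrite ltr_pXn2r ?nnegrE ?rn_ge0 ?sqrtr_ge0// NP.
Qed.

(** The derivative at z is Gam_z tau_z f: the resolvent identities give h Gam_z tau_z tau_(z+h) f as
    the exact error of the difference quotient. *)
Lemma H2_analytic f : analytic_fun (H2_map f).
Proof.
move=> z Oz; have [d d0 dO] := Om_nbhs Oz.
have extE w : Om w -> 'valL_ 0 (H2_map f) w = Gam w f.
  move=> Ow; have := congr1 (fun F : Om -> YY Y => F (SigSub (mem_set Ow)))
    (valLK 0 (H2_map f)).
  by rewrite [RHS]H2_mapE => wE; exact: wE.
have [M M0 MP] := bop_bound (tau z); have [G G0 GP] := bop_bound (Gam z).
apply/cvg_ex; exists (Gam z (tau z f)).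
apply/rn_cvgP => e e0.
pose c := G * (M * (2 * rn (tau z f))) + 1.
have c0 : 0 < c by rewrite ltr_wpDl// !mulr_ge0 ?rn_ge0 ?(ltW G0) ?(ltW M0).
pose r := Num.min d (Num.min (2 * M)^-1 (e / c)).
have r0 : 0 < r by rewrite !lt_min d0 invr_gt0 mulr_gt0//= divr_gt0.
have near0 : \forall h \near (0 : R[i]^o)^', rn (h : R[i]) < r.
  apply: nbhs_dnbhs; apply/nbhs_ballP; exists (r%:C)%C => /=; first by rewrite ltcR.
  move=> h; rewrite -ball_normE /= => h0; have {}h0 : `|0 - h : R[i]| < (r%:C)%C by [].
  by move: h0; rewrite sub0r normrN rnE ltcR.
apply: filterS2 near0 (nbhs_dnbhs_neq (0 : R[i]^o)) => h.
rewrite !lt_min => /and3P[hd hM he] h0.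
have h0' : h != 0 :> R[i] by [].
have hh : h + z - z = h :> R[i] by rewrite addrK.
have Ol : Om (h + z) by apply: dO; rewrite hh.
have hM' : rn (h + z - z) * M <= 2^-1.
  by rewrite hh; move: hM; rewrite invfM ltr_pdivlMr// => /ltW.
have tl := tau_local Oz M0 MP f Ol hM'.
suff lim : rn (h^-1 *: ('valL_ 0 (H2_map f) ((h : R[i]^o) *: (1 : R[i]^o) + z) -
    'valL_ 0 (H2_map f) z) - Gam z (tau z f)) < e by exact: lim.
rewrite [X in X + z]mulr1 !extE//.
have -> : h^-1 *: (Gam (h + z) f - Gam z f) - Gam z (tau z f) =
    h *: Gam z (tau z (tau (h + z) f)).
  have GE : Gam (h + z) f = Gam z f + h *: Gam z (tau (h + z) f).
    by rewrite (Gam_res f Oz Ol); vring.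
  have tE : tau (h + z) f = tau z f + h *: tau z (tau (h + z) f).
    by rewrite {1}(tau_res f Oz Ol); vring.
  rewrite GE addrAC subrr add0r scalerA mulVf// scale1r.
  by rewrite {1}tE (linearD (Gam z)) (linearZ_LR (Gam z)) addrAC subrr add0r.
rewrite rnZ; move: he; rewrite ltr_pdivlMr//; apply: le_lt_trans.
rewrite ler_wpM2l ?rn_ge0// /c ler_wpDr// (le_trans (GP _))// ler_pM2l//.
by rewrite (le_trans (MP _))// ler_pM2l.
Qed.

(** The kernel function for w and u is the image of Gam(w)^* u / 2, so the reproducing property is
    the definition of the adjoint; the double sum of the kernel is half the squared norm of the sum
    of the Gam(w_j)^* u_j. *)
Lemma H2_RKHS (k : R[i] -> R[i] -> YY Y -> YY Y) :
  (forall w z u, Om w -> Om z -> k w z u = 2^-1 *: Gam z (badj (Gam w) u)) ->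
  positive_kernel Om k /\ is_RKHS k (H2 E Y Om).
Proof.
move=> kE; have OmP (z : Om) : Om (\val z) by exact: set_valP.
have kH2 (w : Om) u : (fun z : Om => k (\val w) (\val z) u) =
    H2_map (2^-1 *: badj (Gam (\val w)) u).
  by apply/funext => z; rewrite kE// H2_mapE linearZ.
split.
  move=> n w u.
  pose g := \sum_j badj (Gam (\val (w j))) (u j).
  have -> : \sum_i \sum_j '[k (\val (w j)) (\val (w i)) (u j), u i] = 2^-1 * '[g, g].
    rewrite [in RHS]ip_sumr mulr_sumr; apply: eq_bigr => i _.
    rewrite ip_suml mulr_sumr; apply: eq_bigr => j _.
    by rewrite kE// ipZl badjP.
  by rewrite ipxx mulr_ge0 ?invr_ge0// ler0c sqr_ge0.
split.
- exact: H2_hilbert.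
- by move=> _ [f _ <-]; exact: H2_analytic.
- by move=> w u; rewrite kH2; exists (2^-1 *: badj (Gam (\val w)) u).
- move=> w u _ [f _ <-]; rewrite kH2 H2_innerE ipZr fmorphV rmorph_nat -badjP H2_mapE.
  by rewrite mulrA divff// mul1r.
Qed.

End H2space.

Theorem theorem3p7 (R : realType) (X : hilbertType R) (E : operator X)
    (Y : closed_subspace X) (Om : set R[i]^o)
    (X_separable : separable X)
    (X_infinite_dim : ~ finite_dim [set: X])
    (E_linear : linear_op E)
    (E_closed : closed_op E)
    (E_dense : densely_defined E)
    (E_symmetric : symmetric_op E)
    (E_simple : simple_op E)
    (E_deficiency : infinite_deficiency_indices E)
    (Y_infinite_dim : ~ finite_dim (cs_set Y))
    (Om_nonempty : Om !=set0)
    (Om_open : open Om)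
    (Om_conj : forall z : R[i], Om z -> Om z^*)
    (Om_regular : forall z, Om z -> regular_point E Y z) :
  is_H0U (@J1 R X Y) (H2 E Y Om).
Proof.
have [P [tau PtauE]] :=
  model_ex E_linear E_closed E_symmetric E_simple Om_regular.
pose G := Gam P tau.
have nb := Om_nbhs Om_open.
have tau_res := tau_resolvent E_linear E_closed E_symmetric E_simple Om_regular PtauE.
have Gam_res := Gam_resolvent E_linear E_closed E_symmetric E_simple Om_regular PtauE.
have tau_loc := tau_local_bound E_linear E_closed E_symmetric E_simple Om_regular PtauE.
have lag := lagrange E_linear E_closed E_symmetric E_simple Om_regular PtauE.
have Gam_inj := Gam_injective E_linear E_closed E_symmetric E_simple Om_open
  Om_conj Om_regular PtauE Om_nonempty.
have H2E f (z : Om) : H2_map E Y f z = G (\val z) f.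
  by rewrite GamE; have [-> ->] := PtauE _ (set_valP z) f.
have Y_inf : ~ finite_dim [set: sub_hilbert Y] by move=> /finite_dim_sub.
split; first exact: J1_signature.
(* The isometry [iota] is the inclusion of Y in X, which every Gam(z) carries to the first
   summand. *)
have [|||||||||||||U [Uadm UK Unc]] := @realization R X (YY Y) (sub_hilbert Y) Om (bJ1 Y) tau G
  (binl Y) (binr Y) (bfst Y) (bsnd Y) \val Om_nonempty nb Om_conj (@J1K R X Y)
  (@J1_ip R X Y) tau_res tau_loc Gam_res lag.
- by move=> h u; rewrite binlE ip_hsum /= ip0l addr0.
- by move=> h u; rewrite binrE ip_hsum /= ip0l add0r.
- by move=> u; rewrite binlE binrE; case: u => a b; congr pair; rewrite /= ?addr0 ?add0r.
- by move=> h; rewrite binlE.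
- by move=> h; rewrite binrE.
- by move=> h; rewrite binrE.
- by move=> h; rewrite binlE.
- by move=> u; exact: rn_snd_le.
- by move=> h; rewrite binlE binrE.
- by move=> h; rewrite binlE binrE.
- by [].
- move=> z h Oz; rewrite binlE.
  exact: (Gam_val E_linear E_closed E_symmetric E_simple Om_regular PtauE).
- exact: Y_inf.
exists (fun z => U z); split; [exact: Uadm| |exact: Unc].
exact: (H2_RKHS H2E Gam_inj nb tau_res tau_loc Gam_res UK).
Qed.
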